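(* Let $k$ and $m$ be positive integers and let $U$ be a $2^m\times 2^m$ unitary matrix. Then $U$ can be exactly represented by an $m$-qubit circuit over $\mathcal{G}_{2^k}$ (possibly using ancillas) if and only if every entry of $U$ lies in $\mathbb{Z}[1/2,\zeta_{2^k}]$. Moreover, such a circuit for $U$ can be constructed using a single ancilla when $k\leq 2$, and using at most $k-2$ ancillas when $k>2$.
   Context: Let $\zeta_n=e^{2\pi i/n}$ and let $\mathbb{Z}[1/2,\zeta_n]$ denote the smallest subring of $\mathbb{C}$ containing $1/2$ and $\zeta_n$. Define the gates $H'=\frac12\begin{bmatrix}1+i&1+i\\1+i&-1-i\end{bmatrix}$ (so $H'=\zeta_8H$ with $H=\frac{1}{\sqrt2}\begin{bmatrix}1&1\\1&-1\end{bmatrix}$ the Hadamard gate), $T_n=\mathrm{diag}(1,\zeta_n)$, $S=\mathrm{diag}(1,i)$, $X=\begin{bmatrix}0&1\\1&0\end{bmatrix}$, $CX=I_2\oplus X$ (controlled-NOT), $CCX=I_6\oplus X$ (Toffoli), and $H\otimes H$. The gate sets are: for $n\geq 8$ divisible by 4, $\mathcal{G}_n=\{H',S,CX,T_n\}$; $\mathcal{G}_2=\{X,CX,CCX,H\otimes H\}$; $\mathcal{G}_4=\{X,CX,CCX,S,H'\}$. A circuit over a gate set is a composition of gates from the set applied to arbitrary (ordered) subsets of the qubits, tensored with identities elsewhere. An $m$-qubit circuit using $a$ ancillas exactly represents $U$ if it is a circuit $C$ on $m+a$ qubits such that $C(\ket{u}\otimes\ket{0}^{\otimes a})=(U\ket{u})\otimes\ket{0}^{\otimes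 a}$ for every $\ket{u}\in\mathbb{C}^{2^m}$ (ancillas are initialized and terminated in $\ket{0}$). *)

(* Defs.v *)
(* MathComp + MathComp-Analysis (trigo) + real_closed complex. *)
From Stdlib Require List.
From HB Require Import structures.
From mathcomp Require Import all_boot all_order all_algebra.
From mathcomp Require Import reals trigo.
From mathcomp.real_closed Require Import complex.
Set Implicit Arguments. Unset Strict Implicit. Unset Printing Implicit Defensive.
Import Order.TTheory GRing.Theory Num.Theory.
Local Open Scope ring_scope.
Local Open Scope complex_scope.

(* Complex numbers are R[i] for an arbitrary realType R (all are isomorphic). *)

(* zeta_n = e^{2 pi i / n} = cos(2pi/n) + i sin(2pi/n) *)
Definition zeta (R : realType) (n : nat) : R[i] :=
  (cos (2 * pi / n%:R) +i* sin (2 * pi / n%:R))%C.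

(* Z[1/2, z] : the smallest subring of C containing 1/2 and z. *)
Inductive in_Zhalf (R : realType) (z : R[i]) : R[i] -> Prop :=
| Zh_one  : in_Zhalf z 1
| Zh_half : in_Zhalf z 2^-1
| Zh_gen  : in_Zhalf z z
| Zh_add  x y : in_Zhalf z x -> in_Zhalf z y -> in_Zhalf z (x + y)
| Zh_opp  x : in_Zhalf z x -> in_Zhalf z (- x)
| Zh_mul  x y : in_Zhalf z x -> in_Zhalf z y -> in_Zhalf z (x * y).

Lemma exp2_gt0 n : (0 < 2 ^ n)%N. Proof. by rewrite expn_gt0. Qed.

(* the element (k mod 2^n) of 'I_(2^n) *)
Definition ord2 (n k : nat) : 'I_(2 ^ n) := Ordinal (ltn_pmod k (exp2_gt0 n)).

(* Basis states of n qubits are indexed by 'I_(2^n), big-endian: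
   qubit 0 is the most significant bit. *)
Definition qbit (n : nat) (x : 'I_(2 ^ n)) (q : 'I_n) : bool :=
  odd (x %/ 2 ^ (n.-1 - q)).

(* local index (in a j-qubit gate) of basis state x, for the ordered
   list of qubits f 0, ..., f (j-1) (f 0 the most significant) *)
Definition loc (n j : nat) (f : 'I_j -> 'I_n) (x : 'I_(2 ^ n)) : 'I_(2 ^ j) :=
  ord2 j (\sum_(t < j) (qbit x (f t)) * 2 ^ (j.-1 - t))%N.

(* The gate G on j qubits applied to the (ordered, distinct) qubits f 0..f (j-1)
   of an n-qubit register, tensored with the identity elsewhere. *)
Definition apply_gate (R : realType) (n j : nat) (f : 'I_j -> 'I_n)
    (G : 'M[R[i]]_(2 ^ j)) : 'M[R[i]]_(2 ^ n) :=
  \matrix_(x, y)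
    (if [forall q : 'I_n, (q \notin codom f) ==> (qbit x q == qbit y q)]
     then G (loc f x) (loc f y) else 0).

Record gate (R : realType) := Gate { gdim : nat; gmat : 'M[R[i]]_(2 ^ gdim) }.

(* Circuits over a gate set gs on n qubits (as the unitary they compute). *)
Inductive circuit (R : realType) (gs : seq (gate R)) (n : nat) :
    'M[R[i]]_(2 ^ n) -> Prop :=
| circ_nil : @circuit R gs n 1%:M
| circ_cons (g : gate R) (f : 'I_(gdim g) -> 'I_n) (M : 'M[R[i]]_(2 ^ n)) :
    List.In g gs -> injective f -> @circuit R gs n M ->
    @circuit R gs n (apply_gate f (gmat g) *m M).
Arguments circuit {R} gs n _.

(* |u> (x) |0>^a, with the a ancillas as the last (least significant) qubits *)
Definition with_ancillas (R : realType) (m a : nat) (u : 'cV[R[i]]_(2 ^ m)) :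
    'cV[R[i]]_(2 ^ (m + a)) :=
  \col_x (if (x %% 2 ^ a == 0)%N then u (ord2 m (x %/ 2 ^ a)) 0 else 0).

Arguments with_ancillas {R} m a u.

(* U is exactly represented by an m-qubit circuit over gs using a ancillas *)
Definition exactly_represents (R : realType) (gs : seq (gate R)) (m a : nat)
    (U : 'M[R[i]]_(2 ^ m)) : Prop :=
  exists C : 'M[R[i]]_(2 ^ (m + a)), circuit gs (m + a) C /\
    forall u : 'cV[R[i]]_(2 ^ m),
      C *m with_ancillas m a u = with_ancillas m a (U *m u).

Arguments exactly_represents {R} gs m a U.

Definition unitary (R : realType) (n : nat) (U : 'M[R[i]]_n) : Prop :=
  U *m (\matrix_(i, j) (U j i)^*)%C = 1%:M.

(* ---- gates ---- *)
(* X (j=1), CX = I_2 (+) X (j=2), CCX = I_6 (+) X (j=3): the multiply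
   controlled NOT, identity except the last 2x2 block which is X. *)
Definition mcX (R : realType) (j : nat) : 'M[R[i]]_(2 ^ j) :=
  \matrix_(x, y) (if ((x < 2 ^ j - 2) || (y < 2 ^ j - 2))%N
                  then ((x : nat) == y)%:R else ((x : nat) != y)%:R).
Definition Xg (R : realType) := Gate (mcX R 1).
Definition CXg (R : realType) := Gate (mcX R 2).
Definition CCXg (R : realType) := Gate (mcX R 3).

(* H' = 1/2 [[1+i, 1+i], [1+i, -1-i]] *)
Definition H'mx (R : realType) : 'M[R[i]]_(2 ^ 1) :=
  \matrix_(x, y) ((if ((x : nat) == 1%N) && ((y : nat) == 1%N) then -1 else 1)
                  * ((1 + 'i) / 2))%C.
Definition H'g (R : realType) := Gate (H'mx R).

(* diag(1, c) *)
Definition phase_mx (R : realType) (c : R[i]) : 'M[R[i]]_(2 ^ 1) :=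
  \matrix_(x, y) (if (x : nat) == y then (if (x : nat) == 1%N then c else 1) else 0).
Definition Sg (R : realType) := Gate (phase_mx ('i : R[i])%C).
Definition Tg (R : realType) (n : nat) := Gate (phase_mx (zeta R n)).

(* H (x) H = 1/2 [(-1)^(x1 y1 + x0 y0)] where x = 2 x1 + x0, y = 2 y1 + y0 *)
Definition HHmx (R : realType) : 'M[R[i]]_(2 ^ 2) :=
  \matrix_(x, y) ((-1) ^+ ((x %/ 2) * (y %/ 2) + (x %% 2) * (y %% 2))%N / 2).
Definition HHg (R : realType) := Gate (HHmx R).

(* G_{2^k}: k = 1: {X, CX, CCX, H(x)H}; k = 2: {X, CX, CCX, S, H'};
   k >= 3: {H', S, CX, T_{2^k}}. *)
Definition gateset (R : realType) (k : nat) : seq (gate R) :=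
  if k == 1%N then [:: Xg R; CXg R; CCXg R; HHg R]
  else if k == 2%N then [:: Xg R; CXg R; CCXg R; Sg R; H'g R]
  else [:: H'g R; Sg R; CXg R; Tg R (2 ^ k)].

(* Main.v *)
(* The entries of a circuit lie in the ring generated by the entries of the gates, which gives
   necessity. For sufficiency with k <= 3, let pi generate the prime above 2 in Z, Z[i] or
   Z[zeta_8]. A unit column is w / pi^s with w integral; its squared norm being 1, w has an
   even number of odd entries (a multiple of 4 if k = 1) as soon as s > 0. They can be grouped
   in pairs (quadruples if k = 1), and after multiplication by roots of unity a two-level H'
   (for k = 1, a four-level H (x) H composed with a swap) makes a group even. When all entries
   are even s drops, and for s = 0 the column is a root of unity times a basis vector.
   Permutations, one-level phases and multi-level gates are circuits with one clean ancilla: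
   commutators of controlled gates multiply controls, and determinant obstructions are avoided
   by kicking an opposite phase onto the unused state of the ancilla.
   For k > 3, write U = A + z B with A, B over Z[1/2, z^2]. Then A (x) 1 + B (x) L, where L is
   a 2 x 2 matrix with L^2 = z^2, is unitary because 1 and z are linearly independent over
   Z[1/2, z^2], and it acts as U in presence of the eigenvector T H' |0> of L, so one ancilla
   lowers k by one. *)
Require Import Defs.
From HB Require Import structures.
From mathcomp Require Import all_boot all_order all_algebra.
From mathcomp Require Import fingroup perm algC cyclotomic.
From mathcomp Require Import reals trigo.
From mathcomp.real_closed Require Import complex.
From mathcomp Require Import ring lra zify.
Set Implicit Arguments. Unset Strict Implicit. Unset Printing Implicit Defensive.
Import Order.TTheory GRing.Theory Num.Theory.
Local Open Scope ring_scope.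

(** * Basis states and multiplexed gates *)

(** The direct method stops at k = 3 for the following reason. [H'] divides by [1 - i], so a pair of
    odd entries becomes even only if its sum and difference are divisible by [1 - i] times the
    prime. In Z[i] and Z[w] every odd residue for that modulus is a power of the root of unity, so a
    phase aligns any two odd entries. For sixteenth roots there are sixteen odd residues and only
    eight powers. The catalytic step goes around this at the price of one ancilla per level: 1 at k
    = 3, hence k - 2. The count of odd entries uses only the coefficient at 1 of the norm equation.
    There an entry a + b w + c w^2 + d w^3 contributes a sum of four squares, of the same parity as
    the entry. Comparing such coefficients requires the independence of the powers of w over Q. For
    k = 1 squares modulo 4 give the multiple of four that a four-level gate needs. All independence
    statements rest on the irreducibility of X^(2^k) + 1 over Q. It is obtained in [algC] and
    carried to [R[i]], with [R] arbitrary, as a statement about rational polynomials. *)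

Definition of_bits (n : nat) (b : 'I_n -> bool) : 'I_(2 ^ n) :=
  ord2 n (\sum_(t < n) b t * 2 ^ (n.-1 - t))%N.

Lemma binary_expansion n x : (x < 2 ^ n)%N ->
  (\sum_(t < n) odd (x %/ 2 ^ (n.-1 - t)) * 2 ^ (n.-1 - t))%N = x.
Proof.
elim: n x => [|n IH] x; first by rewrite big_ord0 expn0; case: x.
move=> xlt; rewrite big_ord_recr /= subnn expn0 divn1 muln1.
have e : (x = odd x + (x %/ 2).*2)%N by rewrite divn2 odd_double_half.
have xlt2 : (x %/ 2 < 2 ^ n)%N by rewrite ltn_divLR // -expnSr.
rewrite [RHS]e addnC -[in RHS](IH _ xlt2) -muln2 big_distrl /=; congr (_ + _)%N.
apply: eq_bigr => i _.
have ile := ltn_ord i.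
have -> : (n - i = (n.-1 - i).+1)%N by lia.
by rewrite -divnMA -expnS -mulnA -expnSr.
Qed.

Lemma qbitK n (x : 'I_(2 ^ n)) : of_bits (qbit x) = x.
Proof.
apply: val_inj => /=; rewrite /qbit binary_expansion //.
by rewrite modn_small.
Qed.

Lemma of_bitsK n (b : 'I_n -> bool) q : qbit (of_bits b) q = b q.
Proof.
(* Injectivity of the encoding already follows from [qbitK]; equal cardinalities then make it onto,
   so no digit of the sum has to be computed. *)
pose enc (x : 'I_(2 ^ n)) : {ffun 'I_n -> bool} := [ffun q => qbit x q].
have dec x : of_bits (enc x) = x.
  by rewrite -[RHS]qbitK; congr ord2; apply: eq_bigr => t _; rewrite ffunE.
have enc_inj : injective enc by move=> x y e; rewrite -(dec x) e dec.
have cardE : (#|{ffun 'I_n -> bool}| <= #|'I_(2 ^ n)|)%N.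
  by rewrite card_ffun card_bool !card_ord.
have [x ex] : exists x, enc x = [ffun q => b q].
  by exists (iinv (inj_card_onto enc_inj cardE [ffun q => b q])); rewrite f_iinv.
have -> : of_bits b = x.
  rewrite -(dec x) ex; congr ord2; apply: eq_bigr => t _; by rewrite ffunE.
by move/ffunP: ex => /(_ q); rewrite !ffunE.
Qed.

Lemma qbit_inj n (x y : 'I_(2 ^ n)) : (forall q, qbit x q = qbit y q) -> x = y.
Proof.
by move=> e; rewrite -(qbitK x) -(qbitK y); congr ord2; apply: eq_bigr => t _; rewrite e.
Qed.

(** Literally the test in [apply_gate], so that [apply_gate f G] and [gmux f (fun=> G)] are
    convertible. *)
Definition agree n j (f : 'I_j -> 'I_n) (x y : 'I_(2 ^ n)) :=
  [forall q : 'I_n, (q \notin codom f) ==> (qbit x q == qbit y q)].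

Lemma agreeP n j (f : 'I_j -> 'I_n) (x y : 'I_(2 ^ n)) :
  reflect (forall q, q \notin codom f -> qbit x q = qbit y q) (agree f x y).
Proof.
apply: (iffP forallP) => h q; first by move=> qf; apply/eqP; exact: (implyP (h q)).
by apply/implyP => qf; apply/eqP; exact: h.
Qed.

Lemma agree_refl n j (f : 'I_j -> 'I_n) x : agree f x x.
Proof. exact/agreeP. Qed.

Lemma agree_sym n j (f : 'I_j -> 'I_n) x y : agree f x y = agree f y x.
Proof. by apply/agreeP/agreeP => h q qf; rewrite h. Qed.

Lemma agree_trans n j (f : 'I_j -> 'I_n) : transitive (agree f).
Proof.
by move=> y x z /agreeP xy /agreeP yz; apply/agreeP => q qf; rewrite xy ?yz.
Qed.

Lemma qbit_loc n j (f : 'I_j -> 'I_n) x t : qbit (loc f x) t = qbit x (f t).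
Proof. exact: (of_bitsK (fun t => qbit x (f t))). Qed.

Definition upd n j (f : 'I_j -> 'I_n) (x : 'I_(2 ^ n)) (u : 'I_(2 ^ j)) : 'I_(2 ^ n) :=
  of_bits (fun q => if [pick t | f t == q] is Some t then qbit u t else qbit x q).

Section Upd.
Variables (n j : nat) (f : 'I_j -> 'I_n).
Hypothesis f_inj : injective f.

Lemma qbit_upd x u t : qbit (upd f x u) (f t) = qbit u t.
Proof.
rewrite of_bitsK; case: pickP => [s /eqP /f_inj -> //|/(_ t)]; by rewrite eqxx.
Qed.

Lemma qbit_upd_out x u q : q \notin codom f -> qbit (upd f x u) q = qbit x q.
Proof.
rewrite of_bitsK; case: pickP => [s /eqP <-|//]; by rewrite codom_f.
Qed.

Lemma loc_upd x u : loc f (upd f x u) = u.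
Proof. by apply: qbit_inj => t; rewrite qbit_loc qbit_upd. Qed.

Lemma agree_upd x u : agree f x (upd f x u).
Proof. by apply/agreeP => q qf; rewrite qbit_upd_out. Qed.

Lemma agree_loc_inj x y : agree f x y -> loc f x = loc f y -> x = y.
Proof.
move=> /agreeP xy e; apply: qbit_inj => q.
have [/codomP[t ->]|qf] := boolP (q \in codom f); last exact: xy.
by rewrite -!qbit_loc e.
Qed.

Lemma upd_loc x y : agree f x y -> upd f x (loc f y) = y.
Proof.
move=> xy; apply: agree_loc_inj; last by rewrite loc_upd.
by apply: agree_trans xy; rewrite agree_sym agree_upd.
Qed.

Lemma upd_inj x : injective (upd f x).
Proof. by move=> u v /(congr1 (loc f)); rewrite !loc_upd. Qed.

Lemma upd_agree x y u : agree f x y -> upd f x u = upd f y u.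
Proof.
move=> xy; apply: agree_loc_inj; last by rewrite !loc_upd.
apply: agree_trans (agree_upd _ _).
by apply: agree_trans xy; rewrite agree_sym agree_upd.
Qed.

Lemma sum_agree (V : nmodType) x (F : 'I_(2 ^ n) -> V) :
  \sum_(y | agree f x y) F y = \sum_u F (upd f x u).
Proof.
rewrite (reindex_onto (upd f x) (loc f)) /=; last by move=> y /upd_loc.
by apply: eq_bigl => u; rewrite agree_upd loc_upd eqxx.
Qed.

End Upd.

Section Gmux.
Variables (K : comNzRingType) (n : nat).
Local Notation st := 'I_(2 ^ n).

(* A gate on the qubits [f 0], [f 1], ... controlled by the others: [F x] is meant to depend only
   on the qubits of [x] outside [f] ([indep]). *)
Definition gmux j (f : 'I_j -> 'I_n) (F : st -> 'M[K]_(2 ^ j)) : 'M[K]_(2 ^ n) :=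
  \matrix_(x, y) (if agree f x y then F x (loc f x) (loc f y) else 0).

Definition indep j (f : 'I_j -> 'I_n) T (F : st -> T) :=
  forall x y, agree f x y -> F x = F y.

(** The inner sum runs over the states that agree with [x] off [f], where [F'] is constant, so the
    product is formed block by block. *)
Lemma gmux_mul j (f : 'I_j -> 'I_n) F F' : injective f -> indep f F' ->
  gmux f F *m gmux f F' = gmux f (fun x => F x *m F' x).
Proof.
move=> fi indF; apply/matrixP => x y; rewrite !mxE.
have -> : \sum_z gmux f F x z * gmux f F' z y =
  \sum_(z | agree f x z) F x (loc f x) (loc f z) *
     (if agree f x y then F' x (loc f z) (loc f y) else 0).
  rewrite [RHS]big_mkcond; apply: eq_bigr => z _; rewrite !mxE.
  case: ifP => xz; last by rewrite mul0r.
  rewrite (indF x z xz); congr (_ * _).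
  by have -> : agree f z y = agree f x y
    by apply/idP/idP; apply: agree_trans; rewrite // agree_sym.
rewrite sum_agree //; case: ifP => _.
  by apply: eq_bigr => u _; rewrite loc_upd.
by apply: big1 => u _; rewrite mulr0.
Qed.

Lemma eq_gmux j (f : 'I_j -> 'I_n) F F' : F =1 F' -> gmux f F = gmux f F'.
Proof. by move=> e; apply/matrixP => x y; rewrite !mxE e. Qed.

Lemma gmux1 j (f : 'I_j -> 'I_n) : injective f -> gmux f (fun=> 1%:M) = 1%:M.
Proof.
move=> fi; apply/matrixP => x y; rewrite !mxE.
have [->|ne] := eqVneq x y; first by rewrite agree_refl eqxx.
case: ifP => // xy; case: eqP => // e.
by case/eqP: ne; apply: agree_loc_inj xy e.
Qed.

Lemma gmux_mulv j (f : 'I_j -> 'I_n) F (v : 'cV_(2 ^ n)) x : injective f ->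
  (gmux f F *m v) x 0 = \sum_u F x (loc f x) u * v (upd f x u) 0.
Proof.
move=> fi; rewrite mxE.
transitivity (\sum_(y | agree f x y) F x (loc f x) (loc f y) * v y 0).
  rewrite [RHS]big_mkcond; apply: eq_bigr => y _; rewrite !mxE.
  by case: ifP; rewrite ?mul0r.
rewrite sum_agree //; apply: eq_bigr => u _; by rewrite !loc_upd.
Qed.

(** Rectangular on purpose: adjoining ancillas ([pad], [append0]) is also a matrix of this form. *)
Definition pmx p N (s : 'I_p -> 'I_N) : 'M[K]_(N, p) := \matrix_(x, y) (x == s y)%:R.
Definition dmx N (th : 'I_N -> K) : 'M[K]_N := \matrix_(x, y) (if x == y then th x else 0).

Lemma eq_pmx p N (s s' : 'I_p -> 'I_N) : s =1 s' -> pmx s = pmx s'.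
Proof. by move=> e; apply/matrixP => x y; rewrite !mxE e. Qed.

Lemma eq_dmx N (s s' : 'I_N -> K) : s =1 s' -> dmx s = dmx s'.
Proof. by move=> e; apply/matrixP => x y; rewrite !mxE e. Qed.

Lemma pmx_mul p q N (s : 'I_q -> 'I_N) (s' : 'I_p -> 'I_q) : pmx s *m pmx s' = pmx (s \o s').
Proof.
apply/matrixP => x y; rewrite !mxE (bigD1 (s' y)) //= !mxE eqxx mulr1.
by rewrite big1 ?addr0 // => z /negbTE ne; rewrite !mxE ne mulr0.
Qed.

Lemma dmx_mul N (s s' : 'I_N -> K) : dmx s *m dmx s' = dmx (fun x => s x * s' x).
Proof.
apply/matrixP => x y; rewrite !mxE (bigD1 x) //= !mxE eqxx.
rewrite big1 ?addr0 => [|z ne]; last by rewrite !mxE eq_sym (negbTE ne) mul0r.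
by case: ifP; rewrite ?mulr0.
Qed.

Lemma pmx_id N (s : 'I_N -> 'I_N) : s =1 id -> pmx s = 1%:M.
Proof. by move=> e; apply/matrixP => x y; rewrite !mxE e. Qed.

Lemma dmx1 N (s : 'I_N -> K) : s =1 (fun=> 1) -> dmx s = 1%:M.
Proof. by move=> e; apply/matrixP => x y; rewrite !mxE e; case: eqP. Qed.

Lemma pmx_mull N p (s s' : 'I_N -> 'I_N) (A : 'M_(N, p)) x y :
  cancel s s' -> cancel s' s -> (pmx s *m A) x y = A (s' x) y.
Proof.
move=> k k'; rewrite mxE (bigD1 (s' x)) //= !mxE k' eqxx mul1r.
rewrite big1 ?addr0 // => z ne; rewrite !mxE.
by case: eqP => [e|]; [case/eqP: ne; rewrite e k | rewrite mul0r].
Qed.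

Lemma pmx_mulr p q N (s : 'I_p -> 'I_N) (A : 'M_(q, N)) x y :
  (A *m pmx s) x y = A x (s y).
Proof.
rewrite mxE (bigD1 (s y)) //= !mxE eqxx mulr1.
by rewrite big1 ?addr0 // => z /negbTE ne; rewrite !mxE ne mulr0.
Qed.

Lemma pmx_dmx N (s s' : 'I_N -> 'I_N) th : cancel s s' -> cancel s' s ->
  pmx s *m dmx th *m pmx s' = dmx (th \o s').
Proof.
move=> k k'; apply/matrixP => x y; rewrite pmx_mulr (pmx_mull _ _ _ k k') !mxE.
by rewrite (can_eq k').
Qed.

Lemma dmx_pmx p N (th : 'I_N -> K) (s : 'I_p -> 'I_N) :
  dmx th *m pmx s = pmx s *m dmx (th \o s).
Proof.
apply/matrixP => x y; rewrite pmx_mulr !mxE (bigD1 y) //= !mxE eqxx.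
rewrite big1 ?addr0 => [|z ne]; last by rewrite !mxE (negbTE ne) mulr0.
by case: eqP => [->|_]; rewrite ?mul1r ?mul0r.
Qed.

Lemma dmx_mulv N th (v : 'cV_N) x : (dmx th *m v) x 0 = th x * v x 0.
Proof.
rewrite mxE (bigD1 x) //= !mxE eqxx big1 ?addr0 // => z ne.
by rewrite !mxE eq_sym (negbTE ne) mul0r.
Qed.

Lemma gmux_pmx j (f : 'I_j -> 'I_n) (s : st -> 'I_(2 ^ j) -> 'I_(2 ^ j)) :
  injective f -> indep f s ->
  gmux f (fun x => pmx (s x)) = pmx (fun y => upd f y (s y (loc f y))).
Proof.
move=> fi inds; apply/matrixP => x y; rewrite !mxE.
have [xy|nxy] := boolP (agree f x y).
  rewrite (inds _ _ xy); congr (nat_of_bool _)%:R; apply/eqP/eqP => [e|->]; last by rewrite loc_upd.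
  by rewrite -e -{1}(upd_loc fi (agree_refl f x)) (upd_agree fi _ xy).
case: eqP => // e; case/negP: nxy; rewrite e agree_sym; exact: agree_upd.
Qed.

Lemma gmux_dmx j (f : 'I_j -> 'I_n) (th : st -> K) : injective f ->
  dmx th = gmux f (fun x => dmx (fun u => th (upd f x u))).
Proof.
move=> fi; apply/matrixP => x y; rewrite !mxE.
have [xy|nxy] := boolP (agree f x y).
  rewrite (upd_loc fi (agree_refl f x)).
  congr (if _ then _ else _); apply/eqP/eqP => [->//|]; exact: agree_loc_inj.
by case: eqP => // e; rewrite e agree_refl in nxy.
Qed.

End Gmux.

(** * Controlled gates *)

Section ControlledFlips.
Variable n : nat.
Implicit Types (x : 'I_(2 ^ n)) (A B : seq 'I_n) (t : 'I_n).

Definition ctl A x := all (qbit x) A.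
Definition flip t x : 'I_(2 ^ n) := of_bits (fun q => qbit x q (+) (q == t)).
Definition cflip A t x := if ctl A x then flip t x else x.

Lemma qbit_flip t x q : qbit (flip t x) q = qbit x q (+) (q == t).
Proof. exact: of_bitsK. Qed.

Lemma qbit_cflip A t x q :
  qbit (cflip A t x) q = qbit x q (+) ((q == t) && ctl A x).
Proof.
rewrite /cflip; case: ifP => _; first by rewrite qbit_flip andbT.
by rewrite andbF addbF.
Qed.

Lemma eq_ctl A x y : (forall q, q \in A -> qbit x q = qbit y q) -> ctl A x = ctl A y.
Proof. by move=> e; apply: eq_in_all => q qA; rewrite e. Qed.

Lemma ctl_cflip A B t x : t \notin A -> ctl A (cflip B t x) = ctl A x.
Proof.
move=> tA; apply: eq_ctl => q qA; rewrite qbit_cflip.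
by rewrite (negbTE (memPn tA _ qA)) addbF.
Qed.

Lemma cflipK A t : t \notin A -> involutive (cflip A t).
Proof.
move=> tA x; apply: qbit_inj => q.
by rewrite !qbit_cflip ctl_cflip // -addbA addbb addbF.
Qed.

Lemma cflip_commutator A b d t x : uniq [:: t, b, d & A] ->
  cflip (b :: A) t x = cflip A d (cflip [:: b; d] t (cflip A d (cflip [:: b; d] t x))).
Proof.
rewrite /= !inE !negb_or => /and4P[/and3P[tb td tA] /andP[bd bA] dA _].
apply: qbit_inj => q; rewrite !qbit_cflip !(ctl_cflip _ _ tA) !(ctl_cflip _ _ dA).
rewrite /ctl /= !andbT !qbit_cflip eqxx (negbTE bd).
rewrite (eq_sym b) (eq_sym d) (negbTE td) (negbTE tb) /= !addbF.
rewrite -!/(ctl A _) !(ctl_cflip _ _ tA).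
by case: eqP => _; case: eqP => _; case: (qbit x q); case: (qbit x b);
  case: (qbit x d); case: (ctl A x).
Qed.

End ControlledFlips.

Lemma ctl_loc n j (f : 'I_j -> 'I_n) A x : ctl A (loc f x) = ctl (map f A) x.
Proof. by rewrite /ctl all_map; apply: eq_all => q /=; rewrite qbit_loc. Qed.

Lemma upd_cflip n j (f : 'I_j -> 'I_n) A t x : injective f ->
  upd f x (cflip A t (loc f x)) = cflip (map f A) (f t) x.
Proof.
move=> fi; apply: qbit_inj => q; rewrite [RHS]qbit_cflip -ctl_loc.
have [/codomP[s ->]|qf] := boolP (q \in codom f).
  by rewrite qbit_upd // qbit_cflip qbit_loc (inj_eq fi).
rewrite qbit_upd_out //; case: eqP => [e|_]; last by rewrite addbF.
by rewrite e codom_f in qf.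
Qed.

Definition single n (t : 'I_n) : 'I_1 -> 'I_n := fun=> t.
Lemma single_inj n (t : 'I_n) : injective (single t).
Proof. by move=> i j _; rewrite !ord1. Qed.
#[local] Hint Resolve single_inj : core.

Lemma agree_single n (t : 'I_n) x y :
  agree (single t) x y -> forall q, q != t -> qbit x q = qbit y q.
Proof.
move=> /agreeP h q qt; apply: h; apply/codomP => -[s e]; by rewrite e eqxx in qt.
Qed.

Lemma ctl_indep n (t : 'I_n) A : t \notin A -> indep (single t) (ctl A).
Proof.
move=> tA x y /agree_single h; apply: eq_ctl => q qA; apply: h; exact: (memPn tA).
Qed.

Section OneQubit.
Variable K : comNzRingType.

Definition mx2 (a b c d : K) : 'M[K]_(2 ^ 1) :=
  \matrix_(x, y) (if val x == 0%N then (if val y == 0%N then a else b)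
                  else (if val y == 0%N then c else d)).

Lemma mx2_mul a b c d a' b' c' d' :
  mx2 a b c d *m mx2 a' b' c' d' =
  mx2 (a * a' + b * c') (a * b' + b * d') (c * a' + d * c') (c * b' + d * d').
Proof.
apply/matrixP => -[[|[|//]] ?] [[|[|//]] ?];
by rewrite !mxE [LHS]big_ord_recl /= big_ord_recl big_ord0 !mxE /= addr0.
Qed.

Lemma mx2_1 : mx2 1 0 0 1 = 1%:M.
Proof. by apply/matrixP => -[[|[|//]] ?] [[|[|//]] ?]; rewrite !mxE. Qed.

End OneQubit.

Section Controlled.
Variables (K : comNzRingType) (n : nat).
Implicit Types (A B : seq 'I_n) (t : 'I_n) (G : 'M[K]_(2 ^ 1)).

Definition cgate A t G : 'M[K]_(2 ^ n) :=
  gmux (single t) (fun x => if ctl A x then G else 1%:M).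
Definition cphase A (c : K) : 'M[K]_(2 ^ n) := dmx (fun x => if ctl A x then c else 1).

Lemma cgate_indep A t G : t \notin A ->
  indep (single t) (fun x => if ctl A x then G else 1%:M).
Proof. by move=> tA x y /(ctl_indep tA) ->. Qed.

Lemma cgate_mul A t G G' : t \notin A -> cgate A t G *m cgate A t G' = cgate A t (G *m G').
Proof.
move=> tA; rewrite gmux_mul //; last exact: cgate_indep.
by apply: eq_gmux => x; case: ifP; rewrite ?mulmx1.
Qed.

(** Where only one of the two control lists holds, the pair of gates coming from it cancels; this is
    how controls are multiplied. *)
Lemma cgate_commutator A B t P P' Q Q' : t \notin A -> t \notin B ->
  P *m P' = 1%:M -> Q *m Q' = 1%:M ->
  cgate A t P *m cgate B t Q *m cgate A t P' *m cgate B t Q' =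
  cgate (A ++ B) t (P *m Q *m P' *m Q').
Proof.
move=> tA tB pp qq; rewrite !gmux_mul //; try exact: cgate_indep.
apply: eq_gmux => x; rewrite /ctl all_cat -!/(ctl _ _).
by case: (ctl A x); case: (ctl B x); rewrite ?mulmx1 ?mul1mx ?pp ?qq.
Qed.

Lemma cgate_conj A t P P' Q : t \notin A -> P *m P' = 1%:M ->
  cgate [::] t P *m cgate A t Q *m cgate [::] t P' = cgate A t (P *m Q *m P').
Proof.
move=> tA pp; rewrite !gmux_mul //; try exact: cgate_indep.
by apply: eq_gmux => x; case: (ctl A x); rewrite /= ?mulmx1 ?pp.
Qed.

Lemma cgate_X A t : t \notin A -> cgate A t (mx2 0 1 1 0) = pmx K (cflip A t).
Proof.
move=> tA; pose s x : 'I_(2 ^ 1) -> 'I_(2 ^ 1) := if ctl A x then flip ord0 else id.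
have inds : indep (single t) s by move=> x y /(ctl_indep tA); rewrite /s => ->.
transitivity (gmux (single t) (fun x => pmx K (s x))).
  apply: eq_gmux => x; rewrite /s; case: ifP => _; last by rewrite pmx_id.
  have fE (y : 'I_2) : flip ord0 (y : 'I_(2 ^ 1)) = ord2 1 (y == ord0).
    by apply: qbit_inj => q; rewrite qbit_flip !ord1; case: y => -[|[|//]] ?.
  apply/matrixP => x0 y0; rewrite !mxE fE.
  by case: x0 y0 => -[|[|//]] ? [[|[|//]] ?].
rewrite gmux_pmx //; apply: eq_pmx => y; rewrite /s /cflip.
case: ifP => _; last by rewrite (upd_loc _ (agree_refl _ _)).
by rewrite -[flip _ _]/(cflip [::] _ _) upd_cflip.
Qed.

Lemma mx2_diag (th : 'I_(2 ^ 1) -> K) : dmx th = mx2 (th (ord2 1 0)) 0 0 (th (ord2 1 1)).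
Proof.
apply/matrixP => -[[|[|//]] ?] [[|[|//]] ?]; rewrite !mxE //=; congr th; exact: val_inj.
Qed.

Lemma ctl_upd A t x u : t \notin A -> ctl A (upd (single t) x u) = ctl A x.
Proof.
by move=> tA; rewrite (ctl_indep tA (agree_upd (single t) x u)).
Qed.

Lemma dmx_single t (th : 'I_(2 ^ n) -> K) :
  dmx th = gmux (single t) (fun x => mx2 (th (upd (single t) x (ord2 1 0))) 0 0
                                         (th (upd (single t) x (ord2 1 1)))).
Proof. by rewrite (gmux_dmx _ (@single_inj _ t)); apply: eq_gmux => x; rewrite mx2_diag. Qed.

(** A diagonal gate does not distinguish its target from its controls. *)
Lemma cgate_phase A t c : t \notin A -> cgate A t (mx2 1 0 0 c) = cphase (t :: A) c.
Proof.
move=> tA; rewrite /cphase (dmx_single t); apply: eq_gmux => x.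
rewrite /ctl /= -!/(ctl _ _) !ctl_upd // !(qbit_upd (@single_inj _ t) _ _ ord0 : qbit _ t = _).
by case: ifP => _; rewrite -?mx2_1; congr mx2; rewrite /qbit.
Qed.

Lemma cgate_scalar A t c : t \notin A -> cgate A t (mx2 c 0 0 c) = cphase A c.
Proof.
move=> tA; rewrite /cphase (dmx_single t); apply: eq_gmux => x.
by rewrite !ctl_upd //; case: ifP => _; rewrite -?mx2_1.
Qed.

End Controlled.

(** * Circuits *)

(** A constant that proofs generalize to a variable of square -1 before calling [ring] or
    [field]. *)
Definition imag (R : realType) : R[i] := 'i%C.

Section Zeta.
Variable R : realType.
Local Notation im := (imag R).

Lemma mul_ii : im * im = -1.
Proof. by rewrite -expr2 sqr_i. Qed.

Lemma zeta_sqr n : (0 < n)%N -> zeta R (2 * n) ^+ 2 = zeta R n.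
Proof.
move=> n0; rewrite /zeta; set a := 2 * pi / (2 * n)%:R.
have -> : 2 * pi / n%:R = a + a :> R.
  by rewrite /a natrM; field; rewrite pnatr_eq0 -lt0n.
by rewrite cosD sinD expr2; simpc; congr (_ +i* _)%C; ring.
Qed.

Lemma zeta_2 : zeta R 2 = -1.
Proof.
rewrite /zeta mulrAC divff ?pnatr_eq0 // mul1r cospi sinpi.
by apply/eqP; rewrite eq_complex /= oppr0 !eqxx.
Qed.

Lemma zeta_4 : zeta R 4 = im.
Proof.
rewrite /zeta; have -> : 2 * pi / 4%:R = pi / 2 :> R by field.
by rewrite cos_pihalf sin_pihalf.
Qed.

Lemma zeta_exp2S k : zeta R (2 ^ k.+1) ^+ 2 = zeta R (2 ^ k).
Proof. by rewrite expnS zeta_sqr // expn_gt0. Qed.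

Lemma zeta_exp2 k j : zeta R (2 ^ (k + j)) ^+ (2 ^ j) = zeta R (2 ^ k).
Proof.
elim: j => [|j IH]; first by rewrite addn0 expn0 expr1.
by rewrite addnS [X in _ ^+ X]expnS exprM zeta_exp2S.
Qed.

Lemma zeta_half k : zeta R (2 ^ k.+1) ^+ (2 ^ k) = -1.
Proof. by rewrite -{1}[k.+1]add1n zeta_exp2 zeta_2. Qed.

Lemma zeta_order k : zeta R (2 ^ k.+1) ^+ (2 ^ k.+1) = 1.
Proof. by rewrite [X in _ ^+ X]expnSr exprM zeta_half expr2 mulrNN mulr1. Qed.

Lemma zeta_conj n : zeta R n * (zeta R n)^*%C = 1.
Proof.
rewrite /zeta; simpc; apply/eqP; rewrite eq_complex /= -!expr2 cos2Dsin2 eqxx /=.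
by apply/eqP; ring.
Qed.

Lemma zeta_neq0 n : zeta R n != 0.
Proof. by apply/eqP => e; have := zeta_conj n; rewrite e mul0r => /eqP; rewrite eq_sym oner_eq0. Qed.

End Zeta.

Section Circuits.
Variable R : realType.
Local Notation K := R[i].
Variable gs : seq (gate R).

Lemma circuit_mul n (A B : 'M[K]_(2 ^ n)) :
  circuit gs n A -> circuit gs n B -> circuit gs n (A *m B).
Proof.
by elim=> [|g f M gin fi _ IH] cB; rewrite ?mul1mx // -mulmxA; apply: circ_cons => //; apply: IH.
Qed.

(** Quantified over all registers and placements, so that a product of available gates can be used
    like an elementary gate. *)
Definition avail j (G : 'M[K]_(2 ^ j)) :=
  forall n (f : 'I_j -> 'I_n), injective f -> circuit gs n (gmux f (fun=> G)).

Lemma avail_gate g : List.In g gs -> avail (gmat g).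
Proof. by move=> gin n f fi; rewrite -[gmux _ _]mulmx1; apply: circ_cons gin fi (circ_nil _ _). Qed.

Lemma avail1 j : avail (1%:M : 'M_(2 ^ j)).
Proof. by move=> n f fi; rewrite gmux1 //; apply: circ_nil. Qed.

Lemma avail_mul j (G G' : 'M_(2 ^ j)) : avail G -> avail G' -> avail (G *m G').
Proof.
by move=> aG aG' n f fi; rewrite -gmux_mul //; apply: circuit_mul; [apply: aG|apply: aG'].
Qed.

Lemma avail_phase_exp (c : K) r : avail (mx2 1 0 0 c) -> avail (mx2 1 0 0 (c ^+ r)).
Proof.
move=> ac; elim: r => [|r IH]; first by rewrite expr0 mx2_1; apply: avail1.
have -> : mx2 1 0 0 (c ^+ r.+1) = mx2 1 0 0 c *m mx2 1 0 0 (c ^+ r).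
  by rewrite mx2_mul exprS; congr mx2; ring.
exact: avail_mul.
Qed.

Lemma circuit_inverse :
  (forall g, List.In g gs -> exists2 G', avail G' & gmat g *m G' = 1%:M) ->
  forall n C, circuit gs n C -> exists2 C', circuit gs n C' & C *m C' = 1%:M.
Proof.
move=> hinv n C; elim=> [|g f M gin fi _ [M' cM' MM']].
  by exists 1%:M; [apply: circ_nil|rewrite mulmx1].
have [G' aG' GG'] := hinv g gin; exists (M' *m gmux f (fun=> G')).
  by apply: circuit_mul => //; apply: aG'.
rewrite -mulmxA [M *m _]mulmxA MM' mul1mx -[apply_gate _ _]/(gmux f (fun=> gmat g)).
by rewrite gmux_mul // GG' gmux1.
Qed.

Lemma avail_cgate n (t : 'I_n) G : avail G -> circuit gs n (cgate [::] t G).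
Proof. by move=> aG; exact: (aG _ _ (@single_inj _ t)). Qed.


(** The second branch is the reflection that exchanges the last two indices. *)
Definition mcX_map j (y : nat) : nat :=
  if (y < 2 ^ j - 2)%N then y else (2 ^ j - 2 + (2 ^ j - 1 - y))%N.
Lemma mcX_map_lt j y : (y < 2 ^ j.+1 -> mcX_map j.+1 y < 2 ^ j.+1)%N.
Proof. rewrite /mcX_map expnS. have := exp2_gt0 j; move: (2 ^ j)%N => p p0; case: (ltnP y (2 * p - 2)%N); lia. Qed.

Lemma mcX_pmx j (s : 'I_(2 ^ j.+1) -> 'I_(2 ^ j.+1)) :
  (forall y, val (s y) = mcX_map j.+1 y) -> mcX R j.+1 = pmx K s.
Proof.
move=> e; apply/matrixP => x y; rewrite !mxE -val_eqE e /mcX_map.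
case: x y {e} => x xp [y yp] /=; move: xp yp.
rewrite expnS; have := exp2_gt0 j; move: (2 ^ j)%N => p p0 xp yp.
case: (ltnP y (2 * p - 2)%N) => hy; first by rewrite orbT.
rewrite orbF; case: (ltnP x (2 * p - 2)%N) => hx; congr (nat_of_bool _)%:R; lia.
Qed.

Lemma mcX_cflip1 : mcX R 1 = pmx K (cflip [::] ord0).
Proof.
apply: mcX_pmx => y; rewrite -[RHS](modn_small (mcX_map_lt (ltn_ord y))).
rewrite -[RHS]/(val (ord2 1 (mcX_map 1 y))); apply: (congr1 val).
apply: qbit_inj => q; rewrite qbit_cflip /ctl /= ?andbT /qbit.
move: (ltn_ord y) (ltn_ord q); rewrite -!val_eqE /=.
move: (nat_of_ord y) (nat_of_ord q) => {}y {}q.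
by do 8?[case: y => [|y]] => //; do 3?[case: q => [|q]].
Qed.

Lemma mcX_cflip2 : mcX R 2 = pmx K (cflip [:: ord0] ord_max).
Proof.
apply: mcX_pmx => y; rewrite -[RHS](modn_small (mcX_map_lt (ltn_ord y))).
rewrite -[RHS]/(val (ord2 2 (mcX_map 2 y))); apply: (congr1 val).
apply: qbit_inj => q; rewrite qbit_cflip /ctl /= ?andbT /qbit.
move: (ltn_ord y) (ltn_ord q); rewrite -!val_eqE /=.
move: (nat_of_ord y) (nat_of_ord q) => {}y {}q.
by do 8?[case: y => [|y]] => //; do 3?[case: q => [|q]].
Qed.

Lemma mcX_cflip3 : mcX R 3 = pmx K (cflip [:: ord0; lift ord0 ord0] ord_max).
Proof.
apply: mcX_pmx => y; rewrite -[RHS](modn_small (mcX_map_lt (ltn_ord y))).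
rewrite -[RHS]/(val (ord2 3 (mcX_map 3 y))); apply: (congr1 val).
apply: qbit_inj => q; rewrite qbit_cflip /ctl /= ?andbT /qbit.
move: (ltn_ord y) (ltn_ord q); rewrite -!val_eqE /=.
move: (nat_of_ord y) (nat_of_ord q) => {}y {}q.
by do 8?[case: y => [|y]] => //; do 3?[case: q => [|q]].
Qed.

Definition classical := [/\ avail (mcX R 1), avail (mcX R 2) & avail (mcX R 3)].

Lemma avail_cflip j (A : seq 'I_j) t n (f : 'I_j -> 'I_n) : injective f ->
  avail (pmx K (cflip A t)) -> circuit gs n (pmx K (cflip (map f A) (f t))).
Proof.
move=> fi /(_ n f fi); rewrite gmux_pmx //.
congr circuit; apply: eq_pmx => x; exact: upd_cflip.
Qed.

Lemma tnth_inj_uniq n j (s : j.-tuple 'I_n) : uniq s -> injective (tnth s).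
Proof. by move/tuple_uniqP. Qed.

Lemma circuit_cflip_small n A (t : 'I_n) : classical -> (size A <= 2)%N -> uniq (t :: A) ->
  circuit gs n (pmx K (cflip A t)).
Proof.
case; rewrite mcX_cflip1 mcX_cflip2 mcX_cflip3 => a1 a2 a3.
case: A => [|a [|b [|//]]] _ u.
- exact: (avail_cflip (@single_inj _ t) a1).
- have fi : injective (tnth [tuple a; t]).
    by apply: tnth_inj_uniq; move: u; rewrite /= !inE eq_sym.
  exact: (avail_cflip fi a2).
- have fi : injective (tnth [tuple a; b; t]).
    apply: tnth_inj_uniq; rewrite (perm_uniq (_ : perm_eq _ [:: t; a; b])) //.
    by rewrite -[[:: a; b; t]]/([:: a; b] ++ [:: t]) perm_catC.
  exact: (avail_cflip fi a3).
Qed.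

(* The qubit [d] may be in any state: the commutator restores it. *)
Lemma circuit_cflip n A (t d : 'I_n) : classical -> uniq [:: t, d & A] ->
  circuit gs n (pmx K (cflip A t)).
Proof.
move=> cl; elim: A t d => [|b A IH] t d u.
  by apply: circuit_cflip_small.
have u1 : uniq [:: t, b, d & A].
  by move: u; rewrite /= !inE !negb_or => /and4P[/and3P[-> -> ->] /andP[db ->] -> ->]; rewrite eq_sym db.
rewrite (eq_pmx _ (fun x => cflip_commutator x u1)).
(* The shorter flip has target [d] and borrows [t] as its own spare qubit, so no new qubit is needed
   along the induction. *)
have c1 : circuit gs n (pmx K (cflip A d)).
  by apply: (IH d t); move: u1; rewrite /= !inE !negb_or => /and4P[/and3P[_ td tA] _ -> ->]; rewrite eq_sym td tA.
have c2 : circuit gs n (pmx K (cflip [:: b; d] t)).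
  apply: circuit_cflip_small => //.
  by move: u1; rewrite /= !inE !negb_or => /and4P[/and3P[-> -> _] /andP[-> _] _ _].
have := circuit_mul c1 (circuit_mul c2 (circuit_mul c1 c2)).
by rewrite !pmx_mul.
Qed.

End Circuits.

(** * Toffoli and controlled phases from one-qubit gates and [CX] *)

Section Gates.
Variable R : realType.
Local Notation K := R[i].
Local Notation im := (imag R).
Local Notation X2 := (mx2 0 1 1 0 : 'M[K]_(2 ^ 1)).
Local Notation h := ((1 + im) / 2 : K).
Local Notation h' := ((1 - im) / 2 : K).

Definition Hinv : 'M[K]_(2 ^ 1) := mx2 h' h' h' (- h').

Lemma H'mxE : H'mx R = mx2 h h h (- h).
Proof.
by apply/matrixP => -[[|[|//]] ?] [[|[|//]] ?]; rewrite !mxE /= ?mul1r ?mulN1r.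
Qed.

Lemma phase_mxE (c : K) : phase_mx c = mx2 1 0 0 c.
Proof. by apply/matrixP => -[[|[|//]] ?] [[|[|//]] ?]; rewrite !mxE. Qed.

Lemma mcX1E : mcX R 1 = X2.
Proof. by apply/matrixP => -[[|[|//]] ?] [[|[|//]] ?]; rewrite !mxE. Qed.

Lemma two_neq0 : (2 : K) != 0.
Proof. by rewrite pnatr_eq0. Qed.

Lemma mx2_eqP (a b c d a' b' c' d' : K) : a = a' -> b = b' -> c = c' -> d = d' ->
  mx2 a b c d = mx2 a' b' c' d'.
Proof. by move=> -> -> -> ->. Qed.

Lemma mulH_Hinv : H'mx R *m Hinv = 1%:M.
Proof.
have ii := mul_ii R; have t0 := two_neq0.
rewrite /Hinv H'mxE mx2_mul -mx2_1; move: ii t0; generalize im => j ii t0.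
by apply: mx2_eqP; field: ii.
Qed.

(** The scalar by which [H'] differs from the Hadamard gate cancels; diagonal gates become
    combinations of 1 and [X]. *)
Lemma H_conj_diag (a b : K) : H'mx R *m mx2 a 0 0 b *m Hinv =
  mx2 ((a + b) / 2) ((a - b) / 2) ((a - b) / 2) ((a + b) / 2).
Proof.
have ii := mul_ii R; have t0 := two_neq0.
rewrite /Hinv H'mxE !mx2_mul; move: ii t0; generalize im => j ii t0.
by apply: mx2_eqP; field: ii.
Qed.

Lemma H_sqr : H'mx R *m H'mx R = mx2 im 0 0 im.
Proof.
have ii := mul_ii R; have t0 := two_neq0.
rewrite H'mxE !mx2_mul; move: ii t0; generalize im => j ii t0.
by apply: mx2_eqP; field: ii.
Qed.

(** [H'] squares to the scalar [i], so it has order 8 and its inverse is its seventh power. *)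
Lemma Hinv_pow : Hinv = H'mx R *m (H'mx R *m H'mx R *m (H'mx R *m H'mx R) *m (H'mx R *m H'mx R)).
Proof.
have ii := mul_ii R; have t0 := two_neq0.
have e : mx2 im 0 0 im *m mx2 im 0 0 im = mx2 (-1) 0 0 (-1).
  by rewrite mx2_mul ii; apply: mx2_eqP; ring.
rewrite /Hinv H_sqr e H'mxE !mx2_mul; move: ii t0; generalize im => j ii t0.
by apply: mx2_eqP; field: ii.
Qed.

Section Available.
Variable gs : seq (gate R).
Local Notation av := (avail gs).
Hypothesis avail_H : av (H'mx R).

Lemma avail_Hinv : av Hinv.
Proof. by rewrite Hinv_pow; do 6?apply: avail_mul. Qed.

Lemma circuit_cgate_conjH n A (t : 'I_n) G : t \notin A -> circuit gs n (cgate A t G) ->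
  circuit gs n (cgate A t (H'mx R *m G *m Hinv)).
Proof.
move=> tA cG; rewrite -(cgate_conj _ tA mulH_Hinv).
by apply: circuit_mul; [apply: circuit_mul => //|]; apply: avail_cgate => //; exact: avail_Hinv.
Qed.

(** One term of a phase polynomial. It costs only [CX] gates, which accumulate the parity in [t] and
    then remove it, around a one-qubit phase. *)
Definition parity_phase n (A : seq 'I_n) t (c : K) : 'M[K]_(2 ^ n) :=
  dmx (fun x => if foldr (fun a s => qbit x a (+) s) (qbit x t) A then c else 1).

Lemma parity_phase_nil n (t : 'I_n) c : parity_phase [::] t c = cgate [::] t (mx2 1 0 0 c).
Proof. by rewrite cgate_phase //; apply: eq_dmx => x; rewrite /ctl /= andbT. Qed.

Lemma parity_phase_cons n a A (t : 'I_n) c : a != t -> t \notin A ->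
  parity_phase (a :: A) t c = pmx K (cflip [:: a] t) *m parity_phase A t c *m pmx K (cflip [:: a] t).
Proof.
move=> ta tA; have inv : involutive (cflip [:: a] t) by apply: cflipK; rewrite inE eq_sym.
rewrite (pmx_dmx _ inv inv); apply: eq_dmx => x /=; congr (if _ then _ else _).
elim: A tA => [_|b A IH] /=; first by rewrite qbit_cflip eqxx /ctl /= andbT addbC.
rewrite inE negb_or => /andP[tb /IH <-]; rewrite qbit_cflip eq_sym (negbTE tb) addbF.
by rewrite addbCA.
Qed.

Lemma circuit_parity_phase n A (t : 'I_n) c : av (mcX R 2) -> av (mx2 1 0 0 c) ->
  uniq (t :: A) -> circuit gs n (parity_phase A t c).
Proof.
move=> aCX aT; elim: A => [_|a A IH]; first by rewrite parity_phase_nil; apply: avail_cgate.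
rewrite /= inE negb_or => /andP[/andP[ta tA] /andP[_ uA]].
rewrite parity_phase_cons 1?eq_sym //.
have cx : circuit gs n (pmx K (cflip [:: a] t)).
  have fi : injective (tnth [tuple a; t]).
    by apply/tuple_uniqP; rewrite /= inE eq_sym ta.
  by move: aCX; rewrite mcX_cflip2 => /(avail_cflip fi).
by apply: (circuit_mul (circuit_mul cx _) cx); apply: IH; rewrite /= tA.
Qed.

Section EighthRoot.
Variable w : K.
Hypotheses (aCX : av (mcX R 2)) (aw : av (mx2 1 0 0 w)) (ww : w * w = im).

Let aw' : av (mx2 1 0 0 (w ^+ 7)).
Proof. exact: avail_phase_exp. Qed.

(** From [2ab = a + b - (a (+) b)] and [w ^+ 2 = i]; the factor [w ^+ 7] is the inverse of [w]. *)
Lemma circuit_CS n (b t : 'I_n) : t != b -> circuit gs n (cphase [:: t; b] im).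
Proof.
move=> tb.
have -> : cphase [:: t; b] im = parity_phase [::] b w *m parity_phase [::] t w *m parity_phase [:: b] t (w ^+ 7).
  rewrite /parity_phase !dmx_mul; apply: eq_dmx => x; rewrite /ctl /=.
  have ii := mul_ii R; have w1 : w * w ^+ 7 = 1.
    by move: ww ii; generalize im => j <- e; ring: e.
  have w1' : w ^+ 7 * w = 1 by rewrite mulrC.
  by case: (qbit x t); case: (qbit x b); rewrite /= ?mulr1 ?mul1r ?ww ?w1.
by apply: circuit_mul; [apply: circuit_mul|]; apply: circuit_parity_phase; rewrite //= inE tb.
Qed.

(* [4abc = a + b + c - (a (+) b) - (a (+) c) - (b (+) c) + (a (+) b (+) c)] and [w ^+ 4 = -1]. *)
Lemma circuit_CCX n (a b t : 'I_n) : uniq [:: a; b; t] ->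
  circuit gs n (pmx K (cflip [:: a; b] t)).
Proof.
rewrite /= !inE negb_or andbT => /andP[/andP[ab at_] bt].
have tab : t \notin [:: a; b] by rewrite !inE negb_or eq_sym at_ eq_sym bt.
(* [X] is the Hadamard conjugate of a sign, so only the sign on the states with [a], [b] and [t] all
   set has to be produced. *)
have -> : pmx K (cflip [:: a; b] t) = cgate [:: a; b] t (H'mx R *m mx2 1 0 0 (-1) *m Hinv).
  have t0 := two_neq0.
  by rewrite -cgate_X // H_conj_diag; congr cgate; apply: mx2_eqP; field.
apply: circuit_cgate_conjH => //; rewrite cgate_phase //.
have -> : cphase [:: t; a; b] (-1) =
    parity_phase [::] a w *m parity_phase [::] b w *m parity_phase [::] t w *m parity_phase [:: a] b (w ^+ 7)
    *m parity_phase [:: a] t (w ^+ 7) *m parity_phase [:: b] t (w ^+ 7) *m parity_phase [:: a; b] t w.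
  rewrite /parity_phase !dmx_mul; apply: eq_dmx => x; rewrite /ctl /=.
  have ii := mul_ii R; have w1 : w * w ^+ 7 = 1.
    by move: ww ii; generalize im => j <- e; ring: e.
  have w4 : w * w * w * w = -1 by rewrite -mulrA ww ii.
  case: (qbit x t); case: (qbit x a); case: (qbit x b);
    rewrite /= ?mulr1 ?mul1r ?mulr1 ?mul1r ?w1 ?mul1r ?w4 //; ring: w1.
have ba : b != a by rewrite eq_sym.
have ta : t != a by rewrite eq_sym.
have tb : t != b by rewrite eq_sym.
by do 6?[apply: circuit_mul]; apply: circuit_parity_phase; rewrite //= ?inE ?negb_or ?ba ?ta ?tb ?ab.
Qed.

End EighthRoot.
End Available.

Lemma avail_mcX3 gs : (forall n (a b t : 'I_n), uniq [:: a; b; t] ->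
  circuit gs n (pmx K (cflip [:: a; b] t))) -> avail gs (mcX R 3).
Proof.
move=> hc n f fi; rewrite mcX_cflip3 gmux_pmx //.
rewrite (eq_pmx _ (fun x => upd_cflip _ _ x fi)); apply: hc.
by rewrite -[[:: _; _; _]]/(map f [:: ord0; lift ord0 ord0; ord_max]) map_inj_uniq.
Qed.

End Gates.

(** * What each gate set provides *)

Section GateSets.
Variable R : realType.
Local Notation K := R[i].
Local Notation im := (imag R).
Local Notation av k := (avail (gateset R k)).

Lemma gateset3 k : (2 < k)%N -> gateset R k = [:: H'g R; Sg R; CXg R; Tg R (2 ^ k)].
Proof. by case: k => [|[|[|]]]. Qed.

Lemma avail_T k : (2 < k)%N -> av k (mx2 1 0 0 (zeta R (2 ^ k))).
Proof.
move=> k2; rewrite -phase_mxE; apply: (avail_gate (g := Tg R (2 ^ k))).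
by rewrite gateset3 //=; do 3 right; left.
Qed.

Lemma avail_S k : (1 < k)%N -> av k (mx2 1 0 0 im).
Proof.
rewrite leq_eqVlt => /orP[/eqP <-|k2]; rewrite -phase_mxE; apply: (avail_gate (g := Sg R)).
  by do 3 right; left.
by rewrite gateset3 //=; right; left.
Qed.

Lemma avail_H k : (1 < k)%N -> av k (H'mx R).
Proof.
rewrite leq_eqVlt => /orP[/eqP <-|k2]; apply: (avail_gate (g := H'g R)).
  by do 4 right; left.
by rewrite gateset3 //=; left.
Qed.

Lemma avail_HH : av 1 (HHmx R).
Proof. by apply: (avail_gate (g := HHg R)); do 3 right; left. Qed.

Lemma avail_eighth k : (2 < k)%N ->
  exists2 w : K, av k (mx2 1 0 0 w) & w * w = im.
Proof.
move=> k2; exists (zeta R (2 ^ 3)).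
  rewrite -(@zeta_exp2 R 3 (k - 3)) subnKC //.
  by apply: avail_phase_exp; apply: avail_T.
by rewrite -expr2 zeta_exp2S zeta_4.
Qed.

(** For [k >= 3] neither [X] nor the Toffoli gate is in the set: [X] is [H' S^2 H'^-1], and the
    Toffoli gate comes from the phase polynomial of an eighth root. *)
Lemma gateset_classical k : (0 < k)%N -> classical (gateset R k).
Proof.
case: k => [//|[|[|k]]] _.
- by split; [apply: (avail_gate (g := Xg R)); left|
    apply: (avail_gate (g := CXg R)); right; left|
    apply: (avail_gate (g := CCXg R)); do 2 right; left].
- by split; [apply: (avail_gate (g := Xg R)); left|
    apply: (avail_gate (g := CXg R)); right; left|
    apply: (avail_gate (g := CCXg R)); do 2 right; left].
have aH : av k.+3 (H'mx R) by apply: avail_H.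
have aS : av k.+3 (mx2 1 0 0 im) by apply: avail_S.
have aCX : av k.+3 (mcX R 2) by apply: (avail_gate (g := CXg R)); do 2 right; left.
split=> //.
  have -> : mcX R 1 = H'mx R *m (mx2 1 0 0 im *m mx2 1 0 0 im) *m Hinv R.
    rewrite mx2_mul !mul0r !mulr0 !mulr1 !add0r !addr0 (mul_ii R) H_conj_diag mcX1E.
    have t0 := two_neq0 R; by apply: mx2_eqP; field.
  by apply: avail_mul; [apply: avail_mul => //; apply: avail_mul|apply: avail_Hinv].
have [w aw ww] := @avail_eighth k.+3 isT.
by apply: avail_mcX3 => n a b t u; exact: (circuit_CCX aH aCX aw ww u).
Qed.

Lemma cflip_pmx_sqr j A (t : 'I_j) : t \notin A ->
  pmx K (cflip A t) *m pmx K (cflip A t) = 1%:M.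
Proof. by move=> tA; rewrite pmx_mul pmx_id // => x; exact: cflipK. Qed.

Lemma HH_sqr : HHmx R *m HHmx R = 1%:M.
Proof.
have t0 := two_neq0 R.
apply/matrixP => -[[|[|[|[|//]]]] ?] [[|[|[|[|//]]]] ?];
  rewrite !mxE [LHS]big_ord_recl /= !big_ord_recl big_ord0 !mxE /=;
  rewrite ?(expr0, expr1, sqrrN, expr1n, mulrN, mulNr, mulr1); by field.
Qed.

Lemma gateset_inverse k g : (0 < k)%N -> List.In g (gateset R k) ->
  exists2 G', av k G' & gmat g *m G' = 1%:M.
Proof.
move=> k0; have [a1 a2 a3] := gateset_classical k0.
have x1 : mcX R 1 *m mcX R 1 = 1%:M by rewrite mcX_cflip1 cflip_pmx_sqr.
have x2 : mcX R 2 *m mcX R 2 = 1%:M by rewrite mcX_cflip2 cflip_pmx_sqr.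
have x3 : mcX R 3 *m mcX R 3 = 1%:M by rewrite mcX_cflip3 cflip_pmx_sqr.
have hS : (1 < k)%N -> exists2 G', av k G' & phase_mx im *m G' = 1%:M.
  move=> k1; exists (mx2 1 0 0 (im ^+ 3)).
    by apply: avail_phase_exp; apply: avail_S.
  rewrite phase_mxE mx2_mul -mx2_1 -exprS -[4%N]/(2 * 2)%N exprM sqr_i sqrrN expr1n.
  by apply: mx2_eqP; ring.
have hH : (1 < k)%N -> exists2 G', av k G' & H'mx R *m G' = 1%:M.
  move=> k1; exists (Hinv R); [by apply: avail_Hinv; apply: avail_H|exact: mulH_Hinv].
case: (ltnP 2 k) => [k2|].
  rewrite {1}gateset3 //= => -[<-|[<-|[<-|[<-|//]]]].
  - exact: hH (ltnW k2).
  - exact: hS (ltnW k2).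
  - by exists (mcX R 2).
  exists (mx2 1 0 0 (zeta R (2 ^ k) ^+ (2 ^ k).-1)).
    by apply: avail_phase_exp; apply: avail_T.
  rewrite /= phase_mxE mx2_mul -mx2_1 -exprS prednK ?expn_gt0 //.
  rewrite -[k]prednK // zeta_order; by apply: mx2_eqP; ring.
case: k k0 a1 a2 a3 hS hH => [//|[|[|//]]] _ a1 a2 a3 hS hH _ /=.
  move=> [<-|[<-|[<-|[<-|//]]]].
  - by exists (mcX R 1).
  - by exists (mcX R 2).
  - by exists (mcX R 3).
  - by exists (HHmx R); [apply: avail_HH|exact: HH_sqr].
move=> [<-|[<-|[<-|[<-|[<-|//]]]]].
- by exists (mcX R 1).
- by exists (mcX R 2).
- by exists (mcX R 3).
- exact: hS.
- exact: hH.
Qed.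

Lemma gateset_circuit_inverse k n C : (0 < k)%N -> circuit (gateset R k) n C ->
  exists2 C', circuit (gateset R k) n C' & C *m C' = 1%:M.
Proof.
by move=> k0; apply: circuit_inverse => g; exact: gateset_inverse.
Qed.

End GateSets.

(** * Exact representation with ancillas *)

Definition pad m a (x : 'I_(2 ^ m)) : 'I_(2 ^ (m + a)) := ord2 (m + a) (x * 2 ^ a).

Lemma val_pad m a x : val (@pad m a x) = (x * 2 ^ a)%N.
Proof. by rewrite /= modn_small // expnD ltn_pmul2r ?exp2_gt0. Qed.

Lemma qbit_pad_l m a x q : qbit (@pad m a x) (lshift a q) = qbit x q.
Proof.
rewrite /qbit -[nat_of_ord (pad _ _)]/(val (pad a x)) val_pad /=.
have qm := ltn_ord q.
have -> : ((m + a).-1 - q = (m.-1 - q) + a)%N by lia.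
by rewrite expnD divnMr // exp2_gt0.
Qed.

Lemma qbit_pad_r m a x r : qbit (@pad m a x) (rshift m r) = false.
Proof.
rewrite /qbit -[nat_of_ord (pad _ _)]/(val (pad a x)) val_pad /=.
have ra := ltn_ord r.
have -> : (2 ^ a = 2 ^ r.+1 * 2 ^ ((m + a).-1 - (m + r)))%N.
  by rewrite -expnD; congr (2 ^ _)%N; lia.
by rewrite mulnA mulnK ?exp2_gt0 // expnS mulnCA oddM.
Qed.

Lemma pad_bits m a x (y : 'I_(2 ^ (m + a))) :
  (forall q, qbit y (lshift a q) = qbit x q) -> (forall r, qbit y (rshift m r) = false) ->
  y = pad a x.
Proof.
move=> hl hr; apply: qbit_inj => q; rewrite -(splitK q).
by case: (split q) => r /=; rewrite ?qbit_pad_l ?qbit_pad_r.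
Qed.

Lemma pad_inj m a : injective (@pad m a).
Proof. by move=> x y e; apply: qbit_inj => q; rewrite -(qbit_pad_l a x) -(qbit_pad_l a y) e. Qed.

Lemma ctl_pad m a A x : ctl (map (lshift a) A) (@pad m a x) = ctl A x.
Proof. by rewrite /ctl all_map; apply: eq_all => q /=; rewrite qbit_pad_l. Qed.

Lemma cflip_pad m a A t x :
  cflip (map (lshift a) A) (lshift a t) (@pad m a x) = pad a (cflip A t x).
Proof.
apply: pad_bits => q; rewrite qbit_cflip ctl_pad ?qbit_pad_l ?qbit_pad_r.
  by rewrite qbit_cflip (inj_eq (@lshift_inj _ _)).
by rewrite eq_rlshift.
Qed.

Section Representation.
Variable R : realType.
Local Notation K := R[i].

Lemma with_ancillasE m a (u : 'cV[K]_(2 ^ m)) : with_ancillas m a u = pmx K (pad a) *m u.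
Proof.
apply/matrixP => x j; rewrite !mxE (ord1 j) {j}.
case: ifP => [x0|nx0].
  have xlt : (x %/ 2 ^ a < 2 ^ m)%N by rewrite ltn_divLR ?exp2_gt0 // -expnD.
  have ex : x = pad a (ord2 m (x %/ 2 ^ a)).
    by apply: val_inj; rewrite val_pad /= modn_small // divnK.
  rewrite (bigD1 (ord2 m (x %/ 2 ^ a))) //= !mxE -ex eqxx mul1r big1 ?addr0 // => z zne.
  by rewrite !mxE {1}ex (inj_eq (@pad_inj _ _)) eq_sym (negbTE zne) mul0r.
rewrite big1 // => z _; rewrite !mxE.
case: eqP => [e|]; rewrite ?mul0r //; move: nx0.
by rewrite e -[nat_of_ord (pad _ _)]/(val (pad a z)) val_pad modnMl.
Qed.

(** By linearity basis vectors suffice, and the condition becomes an intertwining relation, which is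
    stable under products and inverses. *)
Lemma exactly_representsE gs m a (U : 'M[K]_(2 ^ m)) : exactly_represents gs m a U <->
  exists2 C, circuit gs (m + a) C & C *m pmx K (pad a) = pmx K (pad a) *m U.
Proof.
split=> [[C [cC h]]|[C cC h]].
  exists C => //; apply/matrixP => x y; move/colP: (h (delta_mx y 0)) => /(_ x).
  by rewrite !with_ancillasE !mulmxA -!colE !mxE.
by exists C; split=> // u; rewrite !with_ancillasE !mulmxA h.
Qed.

Lemma rep_mul gs m a (U V : 'M[K]_(2 ^ m)) :
  exactly_represents gs m a U -> exactly_represents gs m a V ->
  exactly_represents gs m a (U *m V).
Proof.
move=> /exactly_representsE[C cC hC] /exactly_representsE[D cD hD].
apply/exactly_representsE; exists (C *m D); first exact: circuit_mul.
by rewrite -mulmxA hD !mulmxA hC.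
Qed.

Variable k : nat.
Hypothesis k0 : (0 < k)%N.
Local Notation gs := (gateset R k).
Local Notation av := (avail gs).

Lemma rep_inv m a (U V : 'M[K]_(2 ^ m)) : U *m V = 1%:M ->
  exactly_represents gs m a U -> exactly_represents gs m a V.
Proof.
move=> UV /exactly_representsE[C cC hC]; apply/exactly_representsE.
have [C' cC' CC'] := gateset_circuit_inverse k0 cC; exists C' => //.
have C'C := mulmx1C CC'.
by rewrite -[LHS]mulmx1 -UV -mulmxA (mulmxA (pmx _ _)) -hC !mulmxA C'C mul1mx.
Qed.

Section Clean.
Variables m a : nat.
Local Notation rep := (exactly_represents gs m a).
Local Notation l := (lshift a).

Lemma gmux_pad j (f : 'I_j -> 'I_m) (G : 'M[K]_(2 ^ j)) :
  gmux (l \o f) (fun=> G) *m pmx K (pad a) = pmx K (pad a) *m gmux f (fun=> G).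
Proof.
apply/matrixP => x y; rewrite pmx_mulr !mxE.
have loc_pad z : loc (l \o f) (pad a z) = loc f z.
  by apply: qbit_inj => t; rewrite !qbit_loc /= qbit_pad_l.
pose z := of_bits (fun q => qbit x (l q)).
have [ex|nex] := eqVneq x (pad a z).
  rewrite (bigD1 z) //= !mxE -ex eqxx mul1r big1 ?addr0; last first.
    by move=> z' ne; rewrite !mxE ex (inj_eq (@pad_inj _ _)) eq_sym (negbTE ne) mul0r.
  have -> : agree (l \o f) x (pad a y) = agree f z y.
    apply/agreeP/agreeP => h q qf.
      rewrite -(qbit_pad_l a) -ex h ?qbit_pad_l //.
      apply: contra qf => /codomP[t /= /lshift_inj ->]; exact: codom_f.
    rewrite ex -(splitK q); case: (split q) (splitK q) => r /= e; last by rewrite !qbit_pad_r.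
    rewrite !qbit_pad_l h //; apply: contra qf => /codomP[t er].
    by rewrite -e /= er -[l _]/((l \o f) t) codom_f.
  by rewrite ex !loc_pad.
rewrite big1 => [|z' _]; last first.
  rewrite !mxE; case: eqP => [e|]; rewrite ?mul0r //; case/eqP: nex.
  by rewrite e; congr pad; apply: qbit_inj => q; rewrite of_bitsK e qbit_pad_l.
case: ifP => // /agreeP h; case/eqP: nex.
apply: pad_bits => [q|r]; first by rewrite of_bitsK.
rewrite h ?qbit_pad_r //; apply/codomP => -[t /eqP].
by rewrite /= eq_rlshift.
Qed.

Lemma rep_gmux j (f : 'I_j -> 'I_m) G : injective f -> av G ->
  rep (gmux f (fun=> G)).
Proof.
move=> fi aG; apply/exactly_representsE; exists (gmux (l \o f) (fun=> G)); last exact: gmux_pad.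
by apply: aG; apply: inj_comp fi; exact: lshift_inj.
Qed.

(** The first ancilla is the spare qubit of the commutator construction. *)
Lemma rep_cflip A (t : 'I_m) : (0 < a)%N -> uniq (t :: A) -> rep (pmx K (cflip A t)).
Proof.
case: a => [//|b] _ u; apply/exactly_representsE.
exists (pmx K (cflip (map (lshift b.+1) A) (lshift b.+1 t))).
  apply: (circuit_cflip (d := rshift m ord0)); first exact: gateset_classical.
  rewrite -(map_inj_uniq (@lshift_inj m b.+1)) /= in u.
  move: u => /andP[tA uA]; rewrite /= inE negb_or eq_lrshift tA uA /= andbT.
  by apply/mapP => -[q _ /eqP]; rewrite eq_rlshift.
by rewrite !pmx_mul; apply: eq_pmx => x /=; exact: cflip_pad.
Qed.

Lemma rep_cphase A c : circuit gs (m + a) (cphase (map l A) c) -> rep (cphase A c).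
Proof.
move=> cC; apply/exactly_representsE; exists (cphase (map l A) c) => //.
by rewrite /cphase dmx_pmx; congr (_ *m _); apply: eq_dmx => x /=; rewrite ctl_pad.
Qed.

(** A clean ancilla meets only the entry [c]. The freedom in [c'] allows [diag(c, c')] to have
    determinant 1, as a commutator must. *)
Lemma rep_cphase_clean A r c c' :
  circuit gs (m + a) (cgate (map l A) (rshift m r) (mx2 c 0 0 c')) -> rep (cphase A c).
Proof.
move=> cC; apply/exactly_representsE; eexists; first exact: cC.
have tA : rshift m r \notin map l A by apply/mapP => -[q _ /eqP]; rewrite eq_rlshift.
have -> : cgate (map l A) (rshift m r) (mx2 c 0 0 c') =
  dmx (fun x => if ctl (map l A) x then (if qbit x (rshift m r) then c' else c) else 1).
  rewrite (dmx_single (rshift m r)); apply: eq_gmux => x; rewrite !ctl_upd //.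
  rewrite !(qbit_upd (@single_inj _ (rshift m r)) _ _ ord0 : qbit _ (rshift m r) = _).
  by case: ifP => _; rewrite -?mx2_1; congr mx2; rewrite /qbit.
rewrite /cphase dmx_pmx; congr (_ *m _); apply: eq_dmx => x /=.
by rewrite ctl_pad qbit_pad_r.
Qed.

End Clean.

End Representation.

(** * Multiply controlled phases with one ancilla *)

Section Phases.
Variable R : realType.
Local Notation K := R[i].
Local Notation im := (imag R).
Local Notation rep k m := (exactly_represents (gateset R k) m 1).

Lemma HH_conj_X : HHmx R *m pmx K (cflip [::] (ord0 : 'I_2)) *m HHmx R =
  dmx (fun u : 'I_(2 ^ 2) => if qbit u ord0 then -1 else 1).
Proof.
have t0 := two_neq0 R.
have sE (y : 'I_(2 ^ 2)) : cflip [::] (ord0 : 'I_2) y = ord2 2 (val y + 2).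
  by apply: qbit_inj => -[[|[|//]] ?]; rewrite qbit_cflip; case: y => -[|[|[|[|//]]]] ?.
apply/matrixP => x y; rewrite !mxE [LHS]big_ord_recl /= !big_ord_recl big_ord0.
rewrite !pmx_mulr !sE !mxE.
case: x y => -[|[|[|[|//]]]] ? [[|[|[|[|//]]]] ?] /=;
  rewrite ?(expr0, expr1, sqrrN, expr1n, mulrN, mulNr, mulr1); by field.
Qed.

(** A single Hadamard gate is not in the set for k = 1. The second factor of [H (x) H] is spent on
    the ancilla, where the two applications cancel, while on [b] they turn a controlled [X] into a
    controlled sign. *)
Lemma rep_phase1 m (A : seq 'I_m) b : uniq (b :: A) -> rep 1 m (cphase (b :: A) (-1)).
Proof.
move=> u; apply: rep_cphase => /=.
set l := lshift 1; set t : 'I_(m + 1) := rshift m ord0.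
have lt q : l q != t by rewrite eq_lrshift.
pose f := tnth [tuple l b; t].
have fi : injective f by apply/tuple_uniqP; rewrite /= inE lt.
have fE : forall q, q \in map l A -> q \notin codom f.
  move=> q /mapP[p pA ->]; apply/codomP => -[[[|[|//]] ?]]; rewrite /f /tnth /=.
    by move/lshift_inj => e; move: u; rewrite /= -e pA.
  by move/eqP; rewrite (negbTE (lt _)).
have inds T (g g' : T) : indep f (fun x => if ctl (map l A) x then g else g').
  move=> x y /agreeP h; congr (if _ then _ else _); apply: eq_ctl => q qA.
  exact: h (fE q qA).
have cX : circuit (gateset R 1) (m + 1) (pmx K (cflip (map l A) (l b))).
  apply: (circuit_cflip (d := t)); first exact: gateset_classical.
  have := u; rewrite -(map_inj_uniq (@lshift_inj m 1)) /= => /andP[tA uA].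
  rewrite /= inE negb_or lt tA uA /= andbT; apply/mapP => -[q _ /eqP].
  by rewrite eq_sym (negbTE (lt _)).
have cH := avail_HH R fi.
have -> : cphase (l b :: map l A) (-1) =
    gmux f (fun=> HHmx R) *m pmx K (cflip (map l A) (l b)) *m gmux f (fun=> HHmx R).
  have -> : pmx K (cflip (map l A) (l b)) =
    gmux f (fun x => if ctl (map l A) x then pmx K (cflip [::] ord0) else 1%:M).
    transitivity (gmux f (fun x => pmx K (if ctl (map l A) x then cflip [::] ord0 else id))).
      rewrite gmux_pmx //; apply: eq_pmx => x; rewrite /cflip; case: ifP => cx.
        by rewrite -[flip _ (loc f x)]/(cflip [::] _ _) upd_cflip.
      by rewrite (upd_loc fi (agree_refl f x)).
    by apply: eq_gmux => x; case: ifP; rewrite // pmx_id.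
  rewrite !gmux_mul // /cphase (gmux_dmx _ fi); apply: eq_gmux => x.
  have cu v : ctl (l b :: map l A) (upd f x v) = ctl (map l A) x && qbit v ord0.
    rewrite /ctl /= -[l b]/(f ord0) qbit_upd // andbC; congr (_ && _).
    apply: eq_in_all => q qA; exact: qbit_upd_out (fE q qA).
  case: ifP => cx; last first.
    by rewrite mulmx1 HH_sqr; apply: dmx1 => v; rewrite cu cx.
  by rewrite HH_conj_X; apply: eq_dmx => v; rewrite cu cx.
exact: (circuit_mul (circuit_mul cH cX) cH).
Qed.

Section Twisted.
Variables (k m : nat) (A : seq 'I_m) (b : 'I_m).
Hypotheses (k1 : (1 < k)%N) (u : uniq (b :: A)).
Local Notation l := (lshift 1).
Local Notation t := (rshift m ord0 : 'I_(m + 1)).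
Hypothesis CS : circuit (gateset R k) (m + 1) (cphase [:: t; l b] im).

Let tA (B : seq 'I_m) : t \notin map l B.
Proof. by apply/mapP => -[q _ /eqP]; rewrite eq_rlshift. Qed.

Lemma cphase_exp n (B : seq 'I_n) c r : circuit (gateset R k) n (cphase B c) ->
  circuit (gateset R k) n (cphase B (c ^+ r)).
Proof.
move=> cc; elim: r => [|r IH].
  by rewrite /cphase dmx1; [apply: circ_nil | move=> x /=; rewrite expr0; case: ifP].
have -> : cphase B (c ^+ r.+1) = cphase B c *m cphase B (c ^+ r).
  by rewrite dmx_mul; apply: eq_dmx => x; case: ifP; rewrite ?exprS ?mulr1.
exact: circuit_mul.
Qed.

(* [diag(i, -i)] is the commutator of [X] and [S]. *)
Lemma circuit_CiZ : circuit (gateset R k) (m + 1) (cgate (map l (b :: A)) t (mx2 im 0 0 (- im))).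
Proof.
have ii := mul_ii R.
have cX : circuit (gateset R k) (m + 1) (cgate (map l A) t (mx2 0 1 1 0)).
  rewrite cgate_X //; apply: (circuit_cflip (d := l b)).
    by apply: gateset_classical; exact: ltnW.
  have := u; rewrite -(map_inj_uniq (@lshift_inj m 1)) /= => /andP[-> ->].
  by rewrite inE negb_or eq_rlshift tA.
have tb : t \notin [:: l b] by rewrite inE eq_rlshift.
have := cgate_commutator (tA A) tb (_ : mx2 0 1 1 0 *m mx2 0 1 1 0 = 1%:M :> 'M[K]__)
  (_ : mx2 1 0 0 im *m mx2 1 0 0 (im ^+ 3) = 1%:M).
rewrite !cgate_phase // => e.
have -> : cgate (map l (b :: A)) t (mx2 im 0 0 (- im)) =
  cgate (map l A ++ [:: l b]) t
    (mx2 0 1 1 0 *m mx2 1 0 0 im *m mx2 0 1 1 0 *m mx2 1 0 0 (im ^+ 3)).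
  rewrite !mx2_mul; apply: eq_gmux => x; rewrite /ctl all_cat /= andbT andbC.
  congr (if _ then _ else _); move: ii; generalize im => j ii.
  by apply: mx2_eqP; ring: ii.
rewrite -e; last 2 first.
- by rewrite mx2_mul -mx2_1; apply: mx2_eqP; ring.
- rewrite mx2_mul -mx2_1; move: ii; generalize im => j ii.
  by apply: mx2_eqP; ring: ii.
apply: circuit_mul; last exact: cphase_exp.
exact: (circuit_mul (circuit_mul cX CS) cX).
Qed.

Lemma rep_phase_i : rep k m (cphase (b :: A) im).
Proof. apply: rep_cphase_clean circuit_CiZ. Qed.

(* [diag(w, w^-1)] is the commutator of [iX] and [T]; on a clean ancilla it is the scalar [w]. *)
Lemma rep_phase_w w : avail (gateset R k) (mx2 1 0 0 w) -> w * w = im ->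
  rep k m (cphase (b :: A) w).
Proof.
move=> aw ww; have aH := avail_H R k1.
have t0 := two_neq0 R; have ii := mul_ii R.
set B := map l (b :: A).
have cP : circuit (gateset R k) (m + 1) (cgate B t (mx2 0 im im 0)).
  have -> : mx2 0 im im 0 = H'mx R *m mx2 im 0 0 (- im) *m Hinv R.
    by rewrite H_conj_diag; apply: mx2_eqP; field.
  exact: (circuit_cgate_conjH aH (tA _) circuit_CiZ).
have cP' : circuit (gateset R k) (m + 1) (cgate B t (mx2 0 (- im) (- im) 0)).
  have -> : mx2 0 (- im) (- im) 0 = mx2 0 im im 0 *m mx2 0 im im 0 *m mx2 0 im im 0.
    rewrite !mx2_mul; move: ii; generalize im => j ii; by apply: mx2_eqP; ring: ii.
  by rewrite -!cgate_mul ?tA //; apply: circuit_mul => //; apply: circuit_mul.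
have w1 : w * w ^+ 7 = 1 by move: ww ii; generalize im => j <- e; ring: e.
have := cgate_commutator (tA (b :: A)) (isT : t \notin [::])
  (_ : mx2 0 im im 0 *m mx2 0 (- im) (- im) 0 = 1%:M)
  (_ : mx2 1 0 0 w *m mx2 1 0 0 (w ^+ 7) = 1%:M).
rewrite cats0 -/B => e.
apply: (@rep_cphase_clean R k m 1 (b :: A) ord0 w (w ^+ 7)); rewrite -/B.
have -> : mx2 w 0 0 (w ^+ 7) =
  mx2 0 im im 0 *m mx2 1 0 0 w *m mx2 0 (- im) (- im) 0 *m mx2 1 0 0 (w ^+ 7).
  rewrite !mx2_mul; move: ii; generalize im => j ii; apply: mx2_eqP; ring: ii.
rewrite -e; last 2 first.
- rewrite mx2_mul -mx2_1; move: ii; generalize im => j ii; by apply: mx2_eqP; ring: ii.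
- by rewrite mx2_mul -mx2_1 !mul1r !mul0r !mulr0 !addr0 !add0r w1.
apply: circuit_mul; last by apply: avail_cgate; exact: avail_phase_exp.
by apply: (circuit_mul (circuit_mul cP _) cP'); exact: avail_cgate.
Qed.

End Twisted.
End Phases.

(** * Flips of basis states, extension of injections, unitarity *)

Definition top n : 'I_(2 ^ n) := of_bits (fun=> true).

Lemma qbit_top n q : qbit (top n) q = true.
Proof. exact: of_bitsK. Qed.

Lemma flip_ind n (P : 'I_(2 ^ n) -> Prop) :
  P (top n) -> (forall x q, P x -> P (flip q x)) -> forall x, P x.
Proof.
move=> P0 PS x.
(* The qubits listed in [s] already have their value in [x], the others are still true as in
   [top]. *)
have h (s : seq 'I_n) : uniq s -> P (of_bits (fun q => (q \notin s) || qbit x q)).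
  elim: s => [_|q s IH /= /andP[qs us]]; first by rewrite (_ : of_bits _ = top n).
  have [xq|nxq] := boolP (qbit x q).
    rewrite (_ : of_bits _ = of_bits (fun q => (q \notin s) || qbit x q)); first exact: IH.
    apply: qbit_inj => r; rewrite !of_bitsK inE negb_or; case: eqP => [->|//].
    by rewrite xq !orbT.
  rewrite (_ : of_bits _ = flip q (of_bits (fun q => (q \notin s) || qbit x q))); first exact/PS/IH.
  apply: qbit_inj => r; rewrite qbit_flip !of_bitsK inE negb_or; case: eqP => [->|_] /=.
    by rewrite qs (negbTE nxq).
  by rewrite addbF.
have := h _ (enum_uniq 'I_n); rewrite (_ : of_bits _ = x) //; apply: qbit_inj => q.
by rewrite of_bitsK mem_enum.
Qed.

Lemma flipK n (q : 'I_n) : involutive (flip q).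
Proof. by move=> x; apply: qbit_inj => r; rewrite !qbit_flip addbK. Qed.

Lemma flipC n (q r : 'I_n) x : flip q (flip r x) = flip r (flip q x).
Proof. by apply: qbit_inj => s; rewrite !qbit_flip addbAC. Qed.

Lemma ctl_top n (A : seq 'I_n) x : (forall q, q \in A) -> ctl A x = (x == top n).
Proof.
move=> hA; apply/allP/eqP => [h|-> q _]; last exact: qbit_top.
by apply: qbit_inj => q; rewrite qbit_top; apply: h.
Qed.

Lemma perm_extend (T : finType) (s t : seq T) : uniq s -> uniq t -> size s = size t ->
  exists p : {perm T}, map p s = t.
Proof.
elim: s t => [|x s IH] [|y t] //=; first by exists 1%g.
move=> /andP[xs us] /andP[yt ut] [est]; have [p ep] := IH t us ut est.
exists (p * tperm (p x) y)%g; rewrite /= permM tpermL; congr (_ :: _).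
rewrite -ep; apply/eq_in_map => z zs; rewrite permM tpermD //.
  by apply: contra xs => /eqP /perm_inj ->.
by apply: contra yt => /eqP ->; rewrite -ep map_f.
Qed.

(** Lets a gate built on standard levels be carried to arbitrary ones. *)
Lemma perm_extend_inj (T : finType) n (e a : 'I_n -> T) : injective e -> injective a ->
  exists p : {perm T}, forall u, p (e u) = a u.
Proof.
move=> ei ai; have [||| p ep] := @perm_extend T (map e (enum 'I_n)) (map a (enum 'I_n)).
- by rewrite map_inj_uniq ?enum_uniq.
- by rewrite map_inj_uniq ?enum_uniq.
- by rewrite !size_map.
exists p => u; rewrite -map_comp in ep; have /eq_in_map h := ep.
by apply: h; rewrite mem_enum.
Qed.

Section Unitary.
Variable R : realType.
Local Notation K := R[i].

Definition adj n (U : 'M[K]_n) : 'M[K]_n := \matrix_(i, j) (U j i)^*%C.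

Lemma conjcM (x y : K) : (x * y)^*%C = x^*%C * y^*%C.
Proof. exact: rmorphM. Qed.

Lemma adj_mul n (U V : 'M[K]_n) : adj (U *m V) = adj V *m adj U.
Proof.
apply/matrixP => x y; rewrite !mxE rmorph_sum; apply: eq_bigr => z _.
by rewrite !mxE rmorphM mulrC.
Qed.

Lemma adjK n (U : 'M[K]_n) : adj (adj U) = U.
Proof. by apply/matrixP => x y; rewrite !mxE conjcK. Qed.

Lemma adj1 n : adj (1%:M : 'M[K]_n) = 1%:M.
Proof. by apply/matrixP => x y; rewrite !mxE eq_sym; case: eqP; rewrite ?rmorph1 ?rmorph0. Qed.

Lemma unitary1 n : unitary (1%:M : 'M[K]_n).
Proof. by rewrite /unitary -/(adj _) adj1 mulmx1. Qed.

Lemma unitary_mul n (U V : 'M[K]_n) : unitary U -> unitary V -> unitary (U *m V).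
Proof.
rewrite /unitary -!/(adj _) => hU hV; rewrite adj_mul -mulmxA (mulmxA V) hV mul1mx.
exact: hU.
Qed.

Lemma unitary_inv n (U V : 'M[K]_n) : unitary U -> U *m V = 1%:M -> unitary V.
Proof.
rewrite /unitary -!/(adj _) => hU UV; have VU := mulmx1C UV.
have -> : V = adj U by rewrite -[LHS]mulmx1 -hU mulmxA VU mul1mx.
by rewrite adjK; apply: mulmx1C.
Qed.

Lemma unitary_pmx n (s : {perm 'I_n}) : unitary (pmx K s).
Proof.
rewrite /unitary (_ : \matrix_(i, j) _ = pmx K (s^-1)%g).
  by rewrite pmx_mul pmx_id // => x /=; rewrite permKV.
apply/matrixP => x y; rewrite !mxE (_ : (x == (s^-1)%g y) = (y == s x)).
  by case: eqP; rewrite ?rmorph1 ?rmorph0.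
by apply/eqP/eqP => [->|->]; rewrite ?permK ?permKV.
Qed.

Lemma unitary_dmx n (th : 'I_n -> K) : (forall x, th x * (th x)^*%C = 1) -> unitary (dmx th).
Proof.
move=> h; rewrite /unitary (_ : \matrix_(i, j) _ = dmx (fun x => (th x)^*%C)).
  by rewrite dmx_mul; apply: dmx1.
by apply/matrixP => x y; rewrite !mxE eq_sym; case: eqP => [->|]; rewrite ?rmorph0.
Qed.

Lemma unitary_gmux n j (f : 'I_j -> 'I_n) (G : 'M[K]_(2 ^ j)) : injective f -> unitary G ->
  unitary (gmux f (fun=> G)).
Proof.
move=> fi hG; rewrite /unitary (_ : \matrix_(i, j) _ = gmux f (fun=> adj G)).
  by rewrite gmux_mul // -(gmux1 K fi); apply: eq_gmux => x; exact: hG.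
by apply/matrixP => x y; rewrite !mxE agree_sym; case: ifP; rewrite ?rmorph0.
Qed.

End Unitary.

(** * Permutations and one-level phases with one ancilla *)

Section Synth.
Variable R : realType.
Local Notation K := R[i].
Local Notation im := (imag R).

Section CSDirty.
Variable k : nat.
Hypothesis k1 : (1 < k)%N.

(* On the qubit [d], in any state, [X S X S^-1 Z] is the scalar [i]. *)
Lemma circuit_CS_dirty n (b t d : 'I_n) : uniq [:: d; t; b] ->
  circuit (gateset R k) n (cphase [:: t; b] im).
Proof.
move=> u; have ii := mul_ii R; have t0 := two_neq0 R.
have k0 := ltnW k1.
have dA : d \notin [:: t; b] by case/andP: u.
have cX : circuit (gateset R k) n (cgate [:: t; b] d (mx2 0 1 1 0)).
  by rewrite cgate_X //; apply: circuit_cflip_small; first exact: gateset_classical.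
have cS r : circuit (gateset R k) n (cgate [::] d (mx2 1 0 0 (im ^+ r))).
  by apply: avail_cgate; apply: avail_phase_exp; exact: avail_S.
have cZ : circuit (gateset R k) n (cgate [:: t; b] d (mx2 1 0 0 (-1))).
  have -> : mx2 1 0 0 (-1) = H'mx R *m mx2 0 1 1 0 *m Hinv R.
    rewrite H'mxE /Hinv !mx2_mul; move: ii t0; generalize im => j ii t0.
    by apply: mx2_eqP; field: ii.
  apply: circuit_cgate_conjH => //; exact: avail_H.
have := cgate_commutator dA (isT : d \notin [::])
  (_ : mx2 0 1 1 0 *m mx2 0 1 1 0 = 1%:M :> 'M[K]__)
  (_ : mx2 1 0 0 (im ^+ 1) *m mx2 1 0 0 (im ^+ 3) = 1%:M).
rewrite cats0 => e.
have -> : cphase [:: t; b] im = cgate [:: t; b] d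
   (mx2 0 1 1 0 *m mx2 1 0 0 (im ^+ 1) *m mx2 0 1 1 0 *m mx2 1 0 0 (im ^+ 3)) *m
   cgate [:: t; b] d (mx2 1 0 0 (-1)).
  rewrite -(cgate_scalar _ dA) cgate_mul // !mx2_mul; congr cgate.
  move: ii; generalize im => j ii; by apply: mx2_eqP; ring: ii.
apply: circuit_mul cZ; rewrite -e; last 2 first.
- by rewrite mx2_mul -mx2_1; apply: mx2_eqP; ring.
- rewrite mx2_mul -mx2_1; move: ii; generalize im => j ii; by apply: mx2_eqP; ring: ii.
exact: (circuit_mul (circuit_mul (circuit_mul cX (cS _)) cX) (cS _)).
Qed.
End CSDirty.

(** The controlled [S] required by the commutators is made with a borrowed data qubit for k = 2 and
    with eighth roots for k = 3. If k = 2 and [A] is empty there is nothing to borrow, but then the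
    phase is the gate [S] itself. *)
Lemma rep_phase k m (A : seq 'I_m) b : (0 < k <= 3)%N -> uniq (b :: A) ->
  exactly_represents (gateset R k) m 1 (cphase (b :: A) (zeta R (2 ^ k))).
Proof.
case: k => [|[|[|[|//]]]] // _ u.
- by rewrite zeta_2; apply: rep_phase1.
- rewrite -[(2 ^ 2)%N]/4%N zeta_4 -/im; case: A u => [|d A] u.
    by rewrite -cgate_phase //; apply: (rep_gmux _ (@single_inj _ b)) => //; exact: avail_S.
  apply: rep_phase_i => //; apply: (@circuit_CS_dirty 2 _ _ _ _ (lshift 1 d)) => //.
  rewrite /= !inE !negb_or !eq_lrshift eq_rlshift (inj_eq (@lshift_inj _ _)) /= andbT.
  by move: u; rewrite /= inE negb_or eq_sym => /andP[/andP[-> _] _].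
have [w aw ww] := @avail_eighth R 3 isT.
apply: rep_phase_w => //; last by rewrite -expr2 zeta_exp2S zeta_4.
  have [_ aCX _] := gateset_classical R (isT : (0 < 3)%N).
  by apply: (circuit_CS aCX aw ww); rewrite eq_rlshift.
exact: avail_T.
Qed.

(** Unitarity travels with the representation because the column reduction must preserve norms. *)
Definition synth k m (U : 'M[K]_(2 ^ m)) :=
  unitary U /\ exactly_represents (gateset R k) m 1 U.

Variables (k m : nat).
Hypotheses (k13 : (0 < k <= 3)%N) (m0 : (0 < m)%N).
Local Notation syn := (@synth k m).
Local Notation zk := (zeta R (2 ^ k)).
Let k0 : (0 < k)%N. Proof. by case/andP: k13. Qed.

Lemma synth1 : syn 1%:M.
Proof.
split; first exact: unitary1.
by apply/exactly_representsE; exists 1%:M; [exact: circ_nil | rewrite mul1mx mulmx1].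
Qed.

Lemma synth_mul U V : syn U -> syn V -> syn (U *m V).
Proof. by move=> [? ?] [? ?]; split; [exact: unitary_mul|exact: rep_mul]. Qed.

Lemma synth_inv U V : U *m V = 1%:M -> syn U -> syn V.
Proof.
by move=> UV [uU rU]; split; [exact: unitary_inv UV|exact: rep_inv UV rU].
Qed.

Let P (s : {perm 'I_(2 ^ m)}) := syn (pmx K s).

Let PM s s' : P s -> P s' -> P (s * s')%g.
Proof.
move=> hs hs'; have := synth_mul hs' hs; rewrite pmx_mul.
by congr syn; apply: eq_pmx => x; rewrite permM.
Qed.

Let P1 : P 1%g.
Proof. by rewrite /P pmx_id ?perm1 //; [exact: synth1 | move=> x; rewrite perm1]. Qed.

Let flipp q := perm (can_inj (@flipK m q)).

Let P_flip q : P (flipp q).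
Proof.
split; first exact: unitary_pmx.
rewrite (eq_pmx _ (s' := cflip [::] q)); last by move=> x; rewrite permE.
exact: rep_cflip.
Qed.

Let P_conj_flip x y q : P (tperm x y) -> P (tperm (flip q x) (flip q y)).
Proof.
move=> h; have := PM (PM (P_flip q) h) (P_flip q); congr P.
apply/permP => z; rewrite !permM !permE -{2}(flipK q z).
have := @inj_tperm _ _ (flip q) x y (flip q z) (can_inj (@flipK m q)).
by rewrite !permE.
Qed.

Let P_trans x y z : P (tperm x y) -> P (tperm y z) -> P (tperm x z).
Proof.
move=> xy yz; have [->|nxz] := eqVneq x z; first by rewrite tperm1.
have [->//|nxy] := eqVneq x y.
have := PM (PM yz xy) yz; congr P.
have := tpermJ x y (tperm y z); rewrite conjgE tpermV tpermL tpermD 1?eq_sym //.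
by move=> <-; rewrite mulgA.
Qed.

(** An [X] on [q] controlled by all other qubits moves exactly these two states. *)
Let P_top_flip q : P (tperm (top m) (flip q (top m))).
Proof.
split; first exact: unitary_pmx.
rewrite (eq_pmx _ (s' := cflip (rem q (enum 'I_m)) q)).
  apply: rep_cflip => //; rewrite /= rem_uniq ?enum_uniq // mem_rem_uniqF ?enum_uniq //.
move=> x; apply/esym; rewrite /cflip.
have hA r : (r \in rem q (enum 'I_m)) = (r != q).
  by rewrite mem_rem_uniq ?enum_uniq // inE mem_enum andbT.
case: ifP => [/allP h|nh].
  have [xq|nxq] := boolP (qbit x q).
    have -> : x = top m; last by rewrite tpermL.
    apply: qbit_inj => r; rewrite qbit_top; have [->//|rq] := eqVneq r q.
    by apply: h; rewrite hA.
  have ex : x = flip q (top m); last by rewrite {2}ex tpermR ex flipK.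
  apply: qbit_inj => r; rewrite qbit_flip qbit_top; have [->|rq] := eqVneq r q.
    by rewrite (negbTE nxq).
  by apply: h; rewrite hA.
apply/esym; rewrite tpermD //; apply/eqP => e; case/negP: nh; apply/allP => r;
  rewrite hA => rq; rewrite -e ?qbit_flip ?qbit_top ?(negbTE rq) //.
Qed.

(** Neighbours in the hypercube are exchanged by a fully controlled [X] conjugated by flips; paths
    of neighbours give all transpositions, and these generate. *)
Lemma synth_perm (s : {perm 'I_(2 ^ m)}) : syn (pmx K s).
Proof.
have h1 x q : P (tperm x (flip q x)).
  move: x q; apply: flip_ind => [|x r IH] q; first exact: P_top_flip.
  by rewrite flipC; apply: P_conj_flip.
have h2 y : P (tperm (top m) y).
  move: y; apply: flip_ind => [|y q IH]; first by rewrite tperm1.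
  exact: P_trans IH (h1 y q).
have h3 x y : P (tperm x y) by apply: P_trans (h2 y); rewrite tpermC.
rewrite -/(P s); have [ts -> _] := prod_tpermP s.
elim: ts => [|[x y] ts IH]; first by rewrite big_nil; exact: P1.
by rewrite big_cons; exact: PM (h3 x y) IH.
Qed.

(** The phase controlled by all qubits sits at [top]; conjugation by a transposition moves it to
    [a]. *)
Lemma synth_phase (a : 'I_(2 ^ m)) c : (exists r, c = zk ^+ r) ->
  syn (dmx (fun x => if x == a then c else 1)).
Proof.
move=> [r ->].
have h1 : syn (dmx (fun x => if x == a then zk else 1)).
  have : syn (cphase (enum 'I_m) zk).
    split.
      by apply: unitary_dmx => x; case: ifP; rewrite ?zeta_conj // rmorph1 mulr1.
    have em : (0 < size (enum 'I_m))%N by rewrite size_enum_ord.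
    move: em (enum_uniq 'I_m); case: (enum 'I_m) => // b A _; exact: rep_phase.
  move=> ht; have := synth_mul (synth_mul (synth_perm (tperm (top m) a)) ht) (synth_perm (tperm (top m) a)).
  rewrite (pmx_dmx _ (@tpermK _ _ _) (@tpermK _ _ _)); congr syn; apply: eq_dmx => x /=.
  rewrite (ctl_top _ (mem_enum _)); congr (if _ then _ else _).
  by rewrite -(can_eq (@tpermK _ (top m) a) x a) tpermR.
elim: r => [|r IH].
  by rewrite dmx1; [exact: synth1|move=> x /=; rewrite expr0; case: ifP].
have := synth_mul h1 IH; rewrite dmx_mul; congr syn; apply: eq_dmx => x.
by case: ifP; rewrite ?exprS ?mulr1.
Qed.

End Synth.

(** * Gates acting on two or four levels *)

Section Levels.
Variable R : realType.
Local Notation K := R[i].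
Local Notation im := (imag R).
Local Notation syn k m := (@synth R k m).

Definition acts_on j N (G : 'M[K]_j) (a : 'I_j -> 'I_N) (V : 'M[K]_N) :=
  (forall v : 'cV_N, forall u, (V *m v) (a u) 0 = \sum_u' G u u' * v (a u') 0) /\
  (forall v : 'cV_N, forall x, x \notin codom a -> (V *m v) x 0 = v x 0).

(** The fully controlled [G] acts on the levels that agree with [top] off [f]; conjugating by a
    permutation that sends these levels to [a] places it anywhere. *)
Lemma synth_level k m j (f : 'I_j -> 'I_m) G : (0 < k <= 3)%N -> (0 < m)%N ->
  injective f ->
  syn k m (gmux f (fun x => if agree f x (top m) then G else 1%:M)) ->
  forall a : 'I_(2 ^ j) -> 'I_(2 ^ m), injective a ->
  exists2 V, syn k m V & acts_on G a V.
Proof.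
move=> k13 m0 fi sW a ai.
have [p ep] := perm_extend_inj (@upd_inj _ _ _ fi (top m)) ai.
set W := gmux _ _ in sW; exists (pmx K p *m W *m pmx K (p^-1)%g).
  have sp := synth_perm R k13 p; have sp' := synth_perm R k13 (p^-1)%g.
  exact: (synth_mul (synth_mul sp sW) sp').
have VE (v : 'cV[K]_(2 ^ m)) z : (pmx K p *m W *m pmx K (p^-1)%g *m v) (p z) 0 =
   \sum_u (if agree f z (top m) then G else 1%:M) (loc f z) u * v (p (upd f z u)) 0.
  rewrite -!mulmxA (pmx_mull _ _ _ (permK p) (permKV p)) permK gmux_mulv //.
  by apply: eq_bigr => u _; rewrite (pmx_mull _ _ _ (permKV p) (permK p)).
split=> v x.
  rewrite -ep VE agree_sym agree_upd loc_upd //; apply: eq_bigr => u _.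
  by rewrite -ep -(upd_agree fi u (agree_upd f (top m) x)).
move=> xa; rewrite -(permKV p x) VE; set z := (p^-1)%g x.
have -> : agree f z (top m) = false.
  apply/negP; rewrite agree_sym => /(upd_loc fi) e; case/negP: xa.
  by rewrite -(permKV p x) -/z -e ep codom_f.
rewrite (bigD1 (loc f z)) //= !mxE eqxx mul1r (upd_loc _ (agree_refl f z)) //.
rewrite big1 ?addr0 // => u ne; by rewrite !mxE eq_sym (negbTE ne) mul0r.
Qed.

Lemma unitary_H : unitary (H'mx R).
Proof.
rewrite /unitary (_ : \matrix_(i, j) _ = Hinv R); first exact: mulH_Hinv.
rewrite H'mxE /Hinv.
have e : ((1 + im) / 2)^*%C = (1 - im) / 2.
  rewrite conjcM conjc_inv conjc_nat rmorphD rmorph1 /imag; congr (_ * _).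
  by apply/eqP; rewrite eq_complex /= ?oppr0 ?addr0 ?add0r !eqxx.
have adj_mx2 (a b c d : K) : adj (mx2 a b c d) = mx2 a^*%C c^*%C b^*%C d^*%C.
  by apply/matrixP => -[[|[|//]] ?] [[|[|//]] ?]; rewrite !mxE.
have eN : (- ((1 + im) / 2))^*%C = - ((1 - im) / 2) by rewrite -e; exact: rmorphN.
by rewrite -/(adj _) adj_mx2 !e eN.
Qed.

Lemma unitary_HH : unitary (HHmx R).
Proof.
rewrite /unitary (_ : \matrix_(i, j) _ = HHmx R); first exact: HH_sqr.
apply/matrixP => x y; rewrite !mxE conjcM conjc_inv conjc_nat rmorphXn rmorphN rmorph1.
by rewrite mulnC [X in (_ + X)%N]mulnC.
Qed.

(* [H' = S (H' S H'^-1) S], so that controlling the diagonal factors suffices. *)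
Lemma synth_two_level k m (a : 'I_(2 ^ 1) -> 'I_(2 ^ m)) : (1 < k <= 3)%N -> (0 < m)%N ->
  injective a -> exists2 V, syn k m V & acts_on (H'mx R) a V.
Proof.
move=> /andP[k1 k3] m0 ai; have k13 : (0 < k <= 3)%N by rewrite ltnW.
pose q : 'I_m := Ordinal m0.
apply: (synth_level k13 m0 (@single_inj _ q)) => //.
have ii := mul_ii R; have t0 := two_neq0 R.
pose D := gmux (single q) (fun x => if agree (single q) x (top m) then mx2 1 0 0 im else 1%:M).
have sD : syn k m D.
  have : syn k m (dmx (fun x => if x == top m then im else 1)).
    apply: synth_phase => //; exists (2 ^ (k - 2))%N.
    by rewrite -{1}(subnKC k1) zeta_exp2 zeta_4.
  congr synth; rewrite (dmx_single q); apply: eq_gmux => x.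
  have e u : (upd (single q) x u == top m) = agree (single q) x (top m) && (u == ord2 1 1).
    have lt : loc (single q) (top m) = ord2 1 1.
      by apply: qbit_inj => r; rewrite qbit_loc qbit_top !ord1.
    apply/eqP/andP => [e|[xt /eqP ->]].
      by split; [rewrite -e agree_upd|rewrite -lt -e (loc_upd (@single_inj _ q))].
    apply: (agree_loc_inj (f := single q)); last by rewrite (loc_upd (@single_inj _ q)).
    by rewrite agree_sym; apply: agree_trans (agree_upd _ _ _); rewrite agree_sym.
  by rewrite !e eqxx andbT andbF; case: ifP => _; rewrite -?mx2_1.
have aH := avail_H R k1.
have sH : syn k m (gmux (single q) (fun=> H'mx R)).
  by split; [exact: unitary_gmux (@single_inj _ q) unitary_H|exact: (rep_gmux _ (@single_inj _ q))].
have sH' : syn k m (gmux (single q) (fun=> Hinv R)).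
  apply: (synth_inv k13 _ sH); rewrite gmux_mul // ?mulH_Hinv ?gmux1 //; exact: single_inj.
have ind G : indep (single q) (fun x => if agree (single q) x (top m) then G else 1%:M : 'M[K]_(2 ^ 1)).
  move=> x y xy; congr (if _ then _ else _).
  by apply/idP/idP; apply: agree_trans; rewrite // agree_sym.
have := synth_mul (synth_mul sD (synth_mul (synth_mul sH sD) sH')) sD.
have indD := ind (mx2 1 0 0 im); have fi := @single_inj _ q.
have indc : indep (single q) (fun=> Hinv R) by [].
have indH : indep (single q) (fun x =>
    H'mx R *m (if agree (single q) x (top m) then mx2 1 0 0 im else 1%:M) *m Hinv R).
  by move=> x y /indD ->.
rewrite /D (gmux_mul _ fi indD) (gmux_mul _ fi indc).
rewrite (gmux_mul _ fi indH) (gmux_mul _ fi indD).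
(* On the selected levels this is the factorization of [H']; elsewhere the diagonal factors are 1
   and the uncontrolled [H'] and its inverse cancel. *)
congr synth; apply: eq_gmux => x; case: ifP => _.
  rewrite H_conj_diag !mx2_mul H'mxE; move: ii t0; generalize im => j ii t0.
  by apply: mx2_eqP; field: ii.
by rewrite !mul1mx !mulmx1 mulH_Hinv.
Qed.

(** The swap is there for the sake of [F4E]: a controlled [F4] then needs only controlled signs
    between uncontrolled [H (x) H] gates. *)
Definition F4 : 'M[K]_(2 ^ 2) :=
  \matrix_(x, y) ((-1) ^+ ((x %/ 2) * (y %% 2) + (x %% 2) * (y %/ 2))%N / 2).

Definition CZ4 : 'M[K]_(2 ^ 2) := dmx (fun u => if val u == 3 then -1 else 1).

(* The Fourier transform for the hyperbolic form [x1 * x2], whose Gaussian is [CZ4]. *)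
Lemma F4E : CZ4 *m (HHmx R *m CZ4 *m HHmx R) *m CZ4 = F4.
Proof.
have t0 := two_neq0 R.
(* Conjugating a diagonal by [HHmx] gives a matrix that depends only on the bitwise sum of [x] and
   [y], here through [(x1 + y1)(x0 + y0)]. The outer [CZ4] remove [x1 x0] and [y1 y0], which leaves
   the cross terms of [F4]. *)
have -> : HHmx R *m CZ4 *m HHmx R =
  \matrix_(x, y) ((-1) ^+ (((x %/ 2 + y %/ 2) %% 2) * ((x + y) %% 2))%N / 2).
  have -> : HHmx R *m CZ4 = \matrix_(x, y) (HHmx R x y * (if val y == 3 then -1 else 1)).
    apply/matrixP => x y; rewrite !mxE (bigD1 y) //= big1 ?addr0 => [|z ne].
      by rewrite !mxE eqxx.
    by rewrite !mxE (negbTE ne) mulr0.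
  apply/matrixP => -[[|[|[|[|//]]]] ?] [[|[|[|[|//]]]] ?];
    rewrite !mxE [LHS]big_ord_recl /= !big_ord_recl big_ord0 !mxE /=;
    rewrite ?(expr0, expr1, sqrrN, expr1n, mulrN, mulNr, mulr1); by field.
apply/matrixP => x y; rewrite !mxE (bigD1 y) //= big1 ?addr0 => [|z ne]; last first.
  by rewrite !mxE (negbTE ne) mulr0.
rewrite !mxE (bigD1 x) //= big1 ?addr0 => [|z ne]; last first.
  by rewrite !mxE eq_sym (negbTE ne) mul0r.
rewrite !mxE !eqxx; case: x y => -[|[|[|[|//]]]] ? [[|[|[|[|//]]]] ?] /=;
  rewrite ?(expr0, expr1, sqrrN, expr1n, mulrN, mulNr, mulr1); by field.
Qed.

Lemma synth_four_level m (a : 'I_(2 ^ 2) -> 'I_(2 ^ m)) : (1 < m)%N ->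
  injective a -> exists2 V, syn 1 m V & acts_on F4 a V.
Proof.
move=> m1 ai; have m0 := ltnW m1.
pose f : 'I_2 -> 'I_m := widen_ord m1.
have fi : injective f by move=> x y /(congr1 val) /= e; apply: val_inj.
apply: (synth_level (isT : 0 < 1 <= 3)%N m0 fi) => //.
pose D := gmux f (fun x => if agree f x (top m) then CZ4 else 1%:M).
have sD : syn 1 m D.
  have : syn 1 m (dmx (fun x => if x == top m then -1 else 1)).
    by apply: synth_phase => //; exists 1%N; rewrite expr1 zeta_2.
  congr synth; rewrite (gmux_dmx _ fi); apply: eq_gmux => x.
  have e u : (upd f x u == top m) = agree f x (top m) && (val u == 3)%N.
    have lt : loc f (top m) = ord2 2 3.
      by apply: qbit_inj => r; rewrite qbit_loc qbit_top; case: r => -[|[|//]] ?.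
    have -> : (val u == 3)%N = (u == ord2 2 3) by rewrite -val_eqE.
    apply/eqP/andP => [e|[xt /eqP ->]].
      split; first by rewrite -e agree_upd.
      by rewrite -lt -e (loc_upd fi).
    apply: (agree_loc_inj (f := f)); last by rewrite (loc_upd fi).
    by rewrite agree_sym; apply: agree_trans (agree_upd _ _ _); rewrite agree_sym.
  case: ifP => xt; first by apply: eq_dmx => u; rewrite e xt.
  by apply: dmx1 => u; rewrite e xt.
have sH : syn 1 m (gmux f (fun=> HHmx R)).
  by split; [exact: unitary_gmux fi unitary_HH|exact: (rep_gmux _ fi (avail_HH R))].
have ind G : indep f (fun x => if agree f x (top m) then G else 1%:M : 'M[K]_(2 ^ 2)).
  move=> x y xy; congr (if _ then _ else _).
  by apply/idP/idP; apply: agree_trans; rewrite // agree_sym.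
have M := @synth_mul R 1 m.
have := M _ _ (M _ _ sD (M _ _ (M _ _ sH sD) sH)) sD.
have indD := ind CZ4.
have indc : indep f (fun=> HHmx R) by [].
have indH : indep f (fun x =>
    HHmx R *m (if agree f x (top m) then CZ4 else 1%:M) *m HHmx R).
  by move=> x y /indD ->.
rewrite /D (gmux_mul _ fi indD) (gmux_mul _ fi indc).
rewrite (gmux_mul _ fi indH) (gmux_mul _ fi indD).
congr synth; apply: eq_gmux => x; case: ifP => _; first exact: F4E.
by rewrite !mul1mx !mulmx1 HH_sqr.
Qed.

End Levels.

(** * Necessity: entries of circuits *)

Section Zhalf.
Variable R : realType.
Local Notation K := R[i].
Variable z : K.
Local Notation Zh := (in_Zhalf z).

Lemma Zh0 : Zh 0.
Proof. by rewrite -(addrN 1); apply: Zh_add (Zh_opp _); exact: Zh_one. Qed.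

Lemma Zh_sum I (r : seq I) (P : pred I) (F : I -> K) :
  (forall i, P i -> Zh (F i)) -> Zh (\sum_(i <- r | P i) F i).
Proof. by move=> h; elim/big_rec: _ => [|i x Pi]; [exact: Zh0|apply: Zh_add; apply: h]. Qed.

Lemma Zh_exp x n : Zh x -> Zh (x ^+ n).
Proof. by move=> zx; elim: n => [|n IH]; rewrite ?expr0 ?exprS; [exact: Zh_one|exact: Zh_mul]. Qed.

Lemma Zh_mulmx n p q (A : 'M[K]_(n, p)) (B : 'M[K]_(p, q)) :
  (forall x y, Zh (A x y)) -> (forall x y, Zh (B x y)) -> forall x y, Zh ((A *m B) x y).
Proof. by move=> hA hB x y; rewrite mxE; apply: Zh_sum => i _; apply: Zh_mul. Qed.

Lemma Zh_bool (b : bool) : Zh b%:R.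
Proof. by case: b; [exact: Zh_one|exact: Zh0]. Qed.

Lemma Zh_sign n : Zh ((-1) ^+ n).
Proof. by apply: Zh_exp; apply: Zh_opp; exact: Zh_one. Qed.

Lemma Zh_pmx p N (s : 'I_p -> 'I_N) x y : Zh (pmx K s x y).
Proof. by rewrite mxE; exact: Zh_bool. Qed.

End Zhalf.

Section Entries.
Variable R : realType.
Local Notation K := R[i].
Local Notation im := (imag R).
Variable k : nat.
Hypothesis k0 : (0 < k)%N.
Local Notation Zh := (in_Zhalf (zeta R (2 ^ k))).

Lemma Zh_im : (1 < k)%N -> Zh im.
Proof.
move=> k1; rewrite -(zeta_4 R) -[4%N]/(2 ^ 2)%N -(zeta_exp2 R 2 (k - 2)) subnKC //.
by apply: Zh_exp; exact: Zh_gen.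
Qed.

Lemma Zh_gate g : List.In g (gateset R k) -> forall x y, Zh (gmat g x y).
Proof.
have hX j x y : Zh (mcX R j x y) by rewrite mxE; case: ifP => _; exact: Zh_bool.
have hP c : Zh c -> forall x y, Zh (phase_mx c x y).
  by move=> hc x y; rewrite mxE; case: ifP => _; [case: ifP => _ //; exact: Zh_one|exact: Zh0].
have hH : (1 < k)%N -> forall x y, Zh (H'mx R x y).
  move=> k1 x y; rewrite H'mxE mxE.
  have hh : Zh ((1 + im) / 2).
    by apply: Zh_mul (Zh_half _); apply: Zh_add (Zh_im k1); exact: Zh_one.
  by case: ifP => _; case: ifP => _ //; exact: Zh_opp.
have hHH x y : Zh (HHmx R x y) by rewrite mxE; apply: Zh_mul (Zh_half _); exact: Zh_sign.
case: (ltnP 2 k) => k2.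
  rewrite gateset3 //= => -[<-|[<-|[<-|[<-|//]]]] x y; [apply: hH|apply: hP|apply: hX|apply: hP].
  - exact: ltnW.
  - exact: (Zh_im (ltnW k2)).
  - exact: Zh_gen.
move: hX hP hH hHH k2 Zh_im k0; case: k => [//|[|[|//]]] hX hP hH hHH _ hi _ /=.
  by move=> [<-|[<-|[<-|[<-|//]]]] x y; [apply: hX|apply: hX|apply: hX|apply: hHH].
move=> [<-|[<-|[<-|[<-|[<-|//]]]]] x y; [apply: hX|apply: hX|apply: hX|apply: hP|exact: hH].
exact: hi.
Qed.

Lemma Zh_circuit n C : circuit (gateset R k) n C -> forall x y, Zh (C x y).
Proof.
elim=> [|g f M gin fi _ IH] x y; first by rewrite mxE; exact: Zh_bool.
apply: Zh_mulmx => // {}x {}y; rewrite mxE; case: ifP => _; [exact: Zh_gate|exact: Zh0].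
Qed.

(** The entries of [U] are entries of the circuit, at indices whose ancilla part is zero. *)
Lemma Zh_rep m a U : exactly_represents (gateset R k) m a U -> forall x y, Zh (U x y).
Proof.
move=> /exactly_representsE[C cC hC] x y.
have <- : (C *m pmx K (pad a)) (pad a x) y = U x y.
  rewrite hC mxE (bigD1 x) //= mxE eqxx mul1r big1 ?addr0 // => w ne.
  by rewrite mxE (inj_eq (@pad_inj _ _)) eq_sym (negbTE ne) mul0r.
by apply: Zh_mulmx; [exact: Zh_circuit|exact: Zh_pmx].
Qed.

End Entries.

(** * Linear independence of 1 and zeta *)

Section Independence.
Variable R : realType.
Local Notation K := R[i].
Variable k : nat.
Local Notation z := (zeta R (2 ^ k.+1)).
Local Notation "p ^Q" := (map_poly (ratr : rat -> K) p) (at level 2).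

Local Notation Phi := ('X^(2 ^ k) + 1 : {poly rat}).

Lemma size_Phi : size Phi = (2 ^ k).+1.
Proof. by rewrite size_polyDl size_polyXn // size_poly1 ltnS expn_gt0. Qed.

(** In [algC] the polynomial [Phi] vanishes at a primitive root [w] of order [2 ^ k.+1] and has the
    degree of its minimal polynomial. Hence divisibility by [Phi] is vanishing at [w], and a field
    has no zero divisors. *)
Lemma Phi_prime (d e : {poly rat}) : Phi %| d * e -> (Phi %| d) || (Phi %| e).
Proof.
have n0 : (0 < 2 ^ k.+1)%N by rewrite expn_gt0.
have [w prw] := C_prim_root_exists n0.
have [q [eq mq] hq] := minCpolyP w.
have sq : size q = (2 ^ k).+1.
  have := congr1 (fun p : {poly algC} => size p) eq.
  rewrite (minCpoly_cyclotomic prw) size_cyclotomic size_map_poly totient_pfactor //.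
  by rewrite mul1n.
have w2 : w ^+ (2 ^ k) = -1.
  apply/eqP; have /eqP : (w ^+ (2 ^ k)) ^+ 2 = 1.
    by rewrite -exprM -expnSr prim_expr_order.
  rewrite sqrf_eq1 => /orP[|//]; rewrite -(prim_order_dvd prw) => /dvdn_leq.
  by rewrite expn_gt0 => /(_ isT); rewrite leq_exp2l // ltnn.
have hP : q %= Phi.
  rewrite -dvdp_size_eqp ?sq ?size_Phi //.
  rewrite -hq; apply/rootP; rewrite rmorphD rmorph1 /= map_polyXn hornerD hornerXn hornerC w2.
  exact: addNr.
rewrite -!(eqp_dvdl _ hP) -!hq rmorphM; exact: (fun h => etrans (esym (rootM _ _ _)) h).
Qed.

(** The common root makes the gcd of [p] and [Phi] nonconstant. By [Phi_prime], [Phi] divides the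
    gcd or its cofactor in [Phi], and the cofactor has too small a degree. *)
Lemma zeta_root (p : {poly rat}) : root (p^Q) z -> Phi %| p.
Proof.
move=> pz; have Phiz : root (Phi^Q) z.
  apply/rootP; rewrite rmorphD rmorph1 /= map_polyXn hornerD hornerXn hornerC zeta_half.
  exact: addNr.
have dz : root ((gcdp p Phi)^Q) z by rewrite gcdp_map root_gcd pz.
have /dvdpP[e Ee] := dvdp_gcdr p Phi.
have Phi0 : Phi != 0 by rewrite -size_poly_eq0 size_Phi.
have : Phi %| e * gcdp p Phi by rewrite -Ee.
case/Phi_prime/orP => [he|hd]; last exact: dvdp_trans hd (dvdp_gcdl _ _).
have e0 : e != 0 by apply: contraNneq Phi0 => e0; rewrite Ee e0 mul0r.
have g0 : gcdp p Phi != 0 by apply: contraNneq Phi0 => g0; rewrite Ee g0 mulr0.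
have := dvdp_leq e0 he; rewrite {1}Ee size_mul //.
have : (1 < size (gcdp p Phi))%N.
  rewrite -(size_map_poly (ratr : {rmorphism rat -> K})).
  by apply: root_size_gt1 dz; rewrite map_poly_eq0.
have := e0; rewrite -size_poly_gt0; move: (size e) (size (gcdp _ _)) => a b ? ? ?; exfalso; lia.
Qed.

Lemma zeta_indep (p : {poly rat}) : (size p <= 2 ^ k)%N -> root (p^Q) z -> p = 0.
Proof.
move=> sp /zeta_root hd; apply/eqP; apply: contraLR sp => p0.
by rewrite -ltnNge -size_Phi dvdp_leq.
Qed.

(** The exponent [2 ^ k] is even, so [-z] is a root of [Phi] too. This does the work of the field
    automorphism that sends [z] to [-z]. *)
Lemma zeta_conj_root (p : {poly rat}) : (0 < k)%N -> root (p^Q) z -> root (p^Q) (- z).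
Proof.
move=> k0 /zeta_root /dvdpP[q ->]; rewrite rmorphM /= rootM; apply/orP; right.
apply/rootP; rewrite rmorphD rmorph1 /= map_polyXn hornerD hornerXn hornerC exprNn.
rewrite zeta_half -signr_odd oddX /= orbF (gtn_eqF k0) mul1r; exact: addNr.
Qed.

End Independence.

(** * Reduction of columns for k <= 3 *)

(* [(a, b, c, d)] stands for [a + b w + c w^2 + d w^3], [w] a primitive eighth root of unity. *)
Definition quad := (int * int * int * int)%type.

Definition qadd (s t : quad) : quad :=
  let: (a, b, c, d) := s in let: (a', b', c', d') := t in
  (a + a', b + b', c + c', d + d').
Definition qopp (s : quad) : quad := let: (a, b, c, d) := s in (- a, - b, - c, - d).
Definition qmul (s t : quad) : quad :=
  let: (a, b, c, d) := s in let: (a', b', c', d') := t in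
  (a * a' - b * d' - c * c' - d * b', a * b' + b * a' - c * d' - d * c',
   a * c' + b * b' + c * a' - d * d', a * d' + b * c' + c * b' + d * a').

Definition qint (a : int) : quad := (a, 0, 0, 0).

(** Membership in Z, Z[i] and Z[w] for k = 1, 2, 3; one encoding serves all three rings. *)
Definition qlevel (k : nat) (t : quad) : bool :=
  let: (a, b, c, d) := t in
  ((k <= 2)%N ==> (b == 0) && (d == 0)) && ((k <= 1)%N ==> (c == 0)).

(** Divisibility by the prime above 2: roots of unity are 1 in the residue field of two elements, so
    the residue is the coordinate sum. *)
Definition qeven (t : quad) : bool := let: (a, b, c, d) := t in (2 %| a + b + c + d)%Z.

(** The coefficient at 1 of the squared modulus, as [qval_norm] shows. *)
Definition qsq (t : quad) : int :=
  let: (a, b, c, d) := t in a * a + b * b + c * c + d * d.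

(* A generator of the prime above 2 in Z, Z[i], Z[w] respectively. *)
Definition qpi (k : nat) : quad :=
  if k is 1 then (2, 0, 0, 0) else if k is 2 then (1, 0, 1, 0) else (1, 1, 0, 0).

Definition qzeta (k : nat) : quad :=
  if k is 1 then (-1, 0, 0, 0) else if k is 2 then (0, 0, 1, 0) else (0, 1, 0, 0).

Lemma qlevel_add k s t : qlevel k s -> qlevel k t -> qlevel k (qadd s t).
Proof.
move: s t => [[[a b] c] d] [[[a' b'] c'] d'] /=.
by case: (k <= 2)%N; case: (k <= 1)%N => //=; rewrite ?andbT //; lia.
Qed.

Lemma qlevel_opp k s : qlevel k s -> qlevel k (qopp s).
Proof. by move: s => [[[a b] c] d] /=; case: (k <= 2)%N; case: (k <= 1)%N => //=; lia. Qed.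

Lemma qlevel_mul k s t : qlevel k s -> qlevel k t -> qlevel k (qmul s t).
Proof.
move: s t => [[[a b] c] d] [[[a' b'] c'] d'] /=.
case: (leqP k 2) => k2 /=; last by rewrite leqNgt ltnW.
move=> /andP[/andP[/eqP-> /eqP->] h] /andP[/andP[/eqP-> /eqP->] h'].
rewrite !(mul0r, mulr0) ?(addr0, subr0) eqxx /=.
by case: (k <= 1)%N h h' => //= /eqP-> /eqP->; rewrite !(mul0r, mulr0) addr0.
Qed.

Lemma qlevel_pi k : (0 < k <= 3)%N -> qlevel k (qpi k).
Proof. by case: k => [|[|[|[|]]]]. Qed.

Lemma qlevel_zeta k : (0 < k <= 3)%N -> qlevel k (qzeta k).
Proof. by case: k => [|[|[|[|]]]]. Qed.

Lemma qlevel_int k a : qlevel k (qint a).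
Proof. by rewrite /= eqxx !implybT. Qed.

Lemma qdiv_pi k t : (0 < k <= 3)%N -> qlevel k t -> qeven t ->
  exists2 t', qlevel k t' & t = qmul (qpi k) t'.
Proof.
move: t => [[[a b] c] d]; case: k => [|[|[|[|//]]]] //= _.
- move=> /andP[/andP[/eqP-> /eqP->] /eqP->]; rewrite !addr0 => /dvdzP[q ->].
  by exists (q, 0, 0, 0) => //; rewrite /qmul; do 3?congr pair; ring.
- rewrite andbT => /andP[/eqP-> /eqP->]; rewrite !addr0 => /dvdzP[q e].
  exists (q, 0, q - a, 0) => //; rewrite /qmul; do 3?congr pair; lia.
- move=> _ /dvdzP[q e].
  (* Back substitution in [(1 + w) t' = t]; the system closes up because the coordinate sum is
     [2q]. *)
  exists (q - c, b - q + c, q - b, d - q + b) => //; rewrite /qmul; do 3?congr pair; lia.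
Qed.

Lemma qeven_mul_pi k t : (0 < k <= 3)%N -> qlevel k t -> qeven (qmul (qpi k) t).
Proof.
move: t => [[[a b] c] d]; case: k => [|[|[|[|//]]]] //= _.
- move=> /andP[/andP[/eqP-> /eqP->] /eqP->]; lia.
- move=> /andP[/andP[/eqP-> /eqP->] _]; lia.
- move=> _; lia.
Qed.

Lemma sqr_mod2 (a : int) : exists q, a * a = a + 2 * q.
Proof.
have [[q ->]|[q ->]] : (exists q, a = 2 * q) \/ (exists q, a = 2 * q + 1).
- by case: (boolP (2 %| a)%Z) => [/dvdzP[q ->]|h]; [left; exists q; lia|right; exists (a %/ 2)%Z; lia].
- exists (2 * q * q - q); ring.
- exists (2 * q * q + q); ring.
Qed.

(** The modulus for which [qsq] detects oddness: squares are 0 or 1 modulo 4 in Z, while a sum of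
    several coordinate squares is known only modulo 2. It is also the number of levels of the gate
    used, 4 for [F4] and 2 for [H']. *)
Definition qgroup k := if k == 1%N then 4%N else 2%N.

Lemma qsq_mod k t : (0 < k <= 3)%N -> qlevel k t ->
  (qgroup k %| qsq t - (~~ qeven t)%:Z)%Z.
Proof.
move: t => [[[a b] c] d]; case: (eqVneq k 1%N) => [->|k1] k13.
  move=> /andP[/andP[/eqP-> /eqP->] /eqP->]; rewrite /qgroup /= !mulr0 !addr0.
  case: (boolP (2 %| a)%Z) => [/dvdzP[q ->]|h] /=.
    by apply/dvdzP; exists (q * q); ring.
  have [r ->] : exists r, a = 2 * r + 1 by exists (a %/ 2)%Z; lia.
  by apply/dvdzP; exists (r * r + r); ring.
move=> _; rewrite /qgroup (negbTE k1) /=.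
have [qa ->] := sqr_mod2 a; have [qb ->] := sqr_mod2 b.
have [qc ->] := sqr_mod2 c; have [qd ->] := sqr_mod2 d; lia.
Qed.

Lemma qsq_even k t : (0 < k <= 3)%N -> qlevel k t -> qeven t -> (qgroup k %| qsq t)%Z.
Proof. by move=> k13 kt te; have := qsq_mod k13 kt; rewrite te subr0. Qed.

Lemma qsq_ge0 t : 0 <= qsq t.
Proof. by move: t => [[[a b] c] d] /=; nia. Qed.

(** * Values of quadruples, norms and denominators *)

Section Values.
Variable R : realType.
Local Notation K := R[i].
Local Notation im := (imag R).
Local Notation w := (zeta R (2 ^ 3)).

Definition qval (t : quad) : K :=
  let: (a, b, c, d) := t in a%:~R + b%:~R * w + c%:~R * im + d%:~R * (im * w).

Lemma mul_ww : w * w = im.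
Proof. by rewrite -expr2 zeta_exp2S zeta_4. Qed.

Lemma qval_add s t : qval (qadd s t) = qval s + qval t.
Proof. by move: s t => [[[a b] c] d] [[[a' b'] c'] d'] /=; ring. Qed.

Lemma qval_opp s : qval (qopp s) = - qval s.
Proof. by move: s => [[[a b] c] d] /=; ring. Qed.

Lemma qval_mul s t : qval (qmul s t) = qval s * qval t.
Proof.
have ww := mul_ww; have ii := mul_ii R.
move: s t => [[[a b] c] d] [[[a' b'] c'] d'] /=; move: ww ii.
by generalize im w => i v ww ii; ring: ww ii.
Qed.

Lemma qval_int a : qval (qint a) = a%:~R.
Proof. by rewrite /= !mul0r !addr0. Qed.

Lemma qval_zeta k : (0 < k <= 3)%N -> qval (qzeta k) = zeta R (2 ^ k).
Proof.
case: k => [|[|[|[|//]]]] //= _; rewrite ?zeta_2 -?[(2 ^ 2)%N]/4%N ?zeta_4 ?mul0r ?mul1r ?addr0 ?add0r //.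
Qed.

Lemma conj_im : im^*%C = - im.
Proof. by rewrite /imag; apply/eqP; rewrite eq_complex /= oppr0 !eqxx. Qed.

Lemma conj_w : w^*%C = - (im * w).
Proof.
have ww := mul_ww; have ii := mul_ii R.
apply: (mulfI (zeta_neq0 R (2 ^ 3))); rewrite zeta_conj; move: ww ii.
by generalize im w => i v ww ii; ring: ww ii.
Qed.

Lemma conjc_int (a : int) : (a%:~R : K)^*%C = a%:~R.
Proof. exact: rmorph_int. Qed.

(** The coefficient in the squared modulus of [w - w^3], which is the square root of 2. *)
Definition qcross (t : quad) : int := let: (a, b, c, d) := t in a * b + b * c + c * d - d * a.

Lemma qval_norm t : qval t * (qval t)^*%C = qval (qsq t, qcross t, 0, - qcross t).
Proof.
have ww := mul_ww; have ii := mul_ii R.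
move: t => [[[a b] c] d]; rewrite /qval /qsq /qcross.
have -> : (a%:~R + b%:~R * w + c%:~R * im + d%:~R * (im * w))^*%C =
  a%:~R - b%:~R * (im * w) - c%:~R * im - d%:~R * w :> K.
  have cD (x y : K) : (x + y)^*%C = x^*%C + y^*%C by exact: rmorphD.
  have cM (x y : K) : (x * y)^*%C = x^*%C * y^*%C by exact: rmorphM.
  have e : im^*%C * w^*%C = - w by rewrite conj_im conj_w mulrNN mulrA ii mulN1r.
  by rewrite !cD !cM !conjc_int e conj_im conj_w; ring.
move: ww ii; by generalize im w => i v ww ii; ring: ww ii.
Qed.

Lemma qval_eq0 t : qval t = 0 -> t = (0, 0, 0, 0).
Proof.
move: t => [[[a b] c] d] t0.
pose p : {poly rat} := Poly [:: a%:~R; b%:~R; c%:~R; d%:~R].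
have p0 : p = 0.
  apply: (@zeta_indep R 2); first exact: size_Poly.
  apply/rootP; rewrite map_Poly_id0 ?rmorph0 // horner_Poly /= !ratr_int mul0r add0r.
  move: t0 => /= <-; rewrite -mul_ww; ring.
have h i : p`_i = 0 by rewrite p0 coef0.
have := h 0%N; have := h 1%N; have := h 2%N; have := h 3%N; rewrite !coef_Poly /=.
by do 4 (move/eqP; rewrite intr_eq0 => /eqP ->).
Qed.

Lemma qval_inj : injective qval.
Proof.
move=> s t e; have : qval (qadd s (qopp t)) = 0 by rewrite qval_add qval_opp e subrr.
move/qval_eq0; move: s t {e} => [[[a b] c] d] [[[a' b'] c'] d'] /= [h1 h2 h3 h4].
by rewrite (subr0_eq h1) (subr0_eq h2) (subr0_eq h3) (subr0_eq h4).
Qed.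

Lemma qval_sum (I : finType) (F G : I -> int) :
  \sum_j qval (F j, G j, 0, - G j) = qval (\sum_j F j, \sum_j G j, 0, - \sum_j G j).
Proof.
rewrite /= mul0r addr0 rmorphN /= mulNr !rmorph_sum /= !mulr_suml -sumrN -!big_split /=.
by apply: eq_bigr => j _; rewrite addr0 rmorphN /= mulNr.
Qed.

(** Independence of the powers of [w] allows coefficients at 1 to be compared, so a norm equation
    becomes an equation between integers. *)
Lemma sum_norm_qsq (I : finType) (t : I -> quad) p :
  \sum_j qval (t j) * (qval (t j))^*%C = qval p * (qval p)^*%C ->
  \sum_j qsq (t j) = qsq p.
Proof.
under eq_bigr => j _ do rewrite qval_norm.
by rewrite qval_sum qval_norm => /qval_inj [].
Qed.

Lemma qval_pi_neq0 k : (0 < k <= 3)%N -> qval (qpi k) != 0.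
Proof. by move=> hk; apply/eqP => /qval_eq0; move: hk; case: k => [|[|[|[|]]]]. Qed.

(** Up to a unit 2 is the first, second or fourth power of the prime. The last witness is
    [(1 + w)^4 / 2 = 2w + 3w^2 + 2w^3]. *)
Lemma pi_half k : (0 < k <= 3)%N ->
  exists s t, qlevel k t /\ qval (qpi k) ^+ s * 2^-1 = qval t.
Proof.
have t0 := two_neq0 R; have ww := mul_ww; have ii := mul_ii R.
case: k => [|[|[|[|//]]]] // _.
- exists 1%N, (1, 0, 0, 0); split=> //=; move: ww ii; generalize im w => i v ww ii; by field: ww ii.
- exists 2%N, (0, 0, 1, 0); split=> //=; move: ww ii; generalize im w => i v ww ii; by field: ww ii.
- exists 4%N, (0, 2, 3, 2); split=> //=; move: ww ii; generalize im w => i v ww ii; by field: ww ii.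
Qed.

Lemma Zh_denom k x : (0 < k <= 3)%N -> in_Zhalf (zeta R (2 ^ k)) x ->
  exists s t, qlevel k t /\ qval (qpi k) ^+ s * x = qval t.
Proof.
move=> hk.
have up t : qlevel k t -> forall r, exists2 t', qlevel k t' &
    qval (qpi k) ^+ r * qval t = qval t'.
  move=> kt; elim=> [|r [t' kt' e]]; first by exists t; rewrite // mul1r.
  exists (qmul (qpi k) t'); first exact: qlevel_mul (qlevel_pi hk) kt'.
  by rewrite qval_mul -e exprS mulrA.
elim=> [|||y y' _ [s [t [kt e]]] _ [s' [t' [kt' e']]]|y _ [s [t [kt e]]]|
        y y' _ [s [t [kt e]]] _ [s' [t' [kt' e']]]].
- by exists 0%N, (qint 1); rewrite qlevel_int qval_int mulr1.
- exact: pi_half.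
- by exists 0%N, (qzeta k); rewrite qlevel_zeta // qval_zeta // mul1r.
- have [u ku eu] := up t kt s'; have [u' ku' eu'] := up t' kt' s.
  exists (s + s')%N, (qadd u u'); split; first exact: qlevel_add.
  by rewrite qval_add -eu -eu' -e -e' exprD; ring.
- by exists s, (qopp t); rewrite qlevel_opp // qval_opp -e mulrN.
- exists (s + s')%N, (qmul t t'); split; first exact: qlevel_mul.
  by rewrite qval_mul -e -e' exprD; ring.
Qed.

End Values.

(** * Making groups of odd numerators even *)

Section Reduce.
Variable R : realType.
Local Notation K := R[i].
Local Notation im := (imag R).
Local Notation qv := (@qval R).
Local Notation zk k := (zeta R (2 ^ k)).

Lemma qval_zeta_mul k e t : (0 < k <= 3)%N -> qlevel k t ->
  qlevel k (iter e (qmul (qzeta k)) t) /\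
  zk k ^+ e * qv t = qv (iter e (qmul (qzeta k)) t).
Proof.
move=> hk kt; elim: e => [|e [IH1 IH2]]; first by rewrite mul1r.
split; first by apply: qlevel_mul IH1; exact: qlevel_zeta.
by rewrite /= qval_mul -IH2 qval_zeta // exprS mulrA.
Qed.

(* Modulo the ideal generated by 2 and 1 + w + w^2 + w^3, every odd element is a power of the
   root of unity. *)
Lemma odd_normal k t : (1 < k <= 3)%N -> qlevel k t -> ~~ qeven t ->
  exists e a b c d,
    [/\ qlevel k (a, b, c, d), zk k ^+ e * qv t = qv (a, b, c, d),
        (2 %| a + b + 1)%Z, (2 %| b + c)%Z & (2 %| c + d)%Z].
Proof.
move=> /andP[k1 k3] kt te; have hk : (0 < k <= 3)%N by rewrite ltnW.
suff [e [a [b [c [d [E h1 h2 h3]]]]]] : exists e a b c d,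
    [/\ iter e (qmul (qzeta k)) t = (a, b, c, d),
        (2 %| a + b + 1)%Z, (2 %| b + c)%Z & (2 %| c + d)%Z].
  have [l1 l2] := qval_zeta_mul e hk kt.
  by exists e, a, b, c, d; rewrite -E.
move: t kt te => [[[a b] c] d]; case: k k1 k3 {hk} => [|[|[|[|//]]]] //= _ _.
  rewrite andbT => /andP[/eqP-> /eqP->] te.
  case: (boolP (2 %| c)%Z) => hc.
    by exists 0%N; do 4 eexists; split; first reflexivity; lia.
  by exists 1%N; do 4 eexists; split; first reflexivity; lia.
move=> _ te.
(* Modulo 2 and up to adding (1, 1, 1, 1), an odd vector is one of the four unit vectors, and
   multiplication by [w] rotates them. *)
have [h|h|h|h] : [\/ [&& (2 %| a + b + 1)%Z, (2 %| b + c)%Z & (2 %| c + d)%Z],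
   [&& (2 %| d + a + 1)%Z, (2 %| a + b)%Z & (2 %| b + c)%Z],
   [&& (2 %| c + d + 1)%Z, (2 %| d + a)%Z & (2 %| a + b)%Z] |
   [&& (2 %| b + c + 1)%Z, (2 %| c + d)%Z & (2 %| d + a)%Z]].
- case: (boolP (2 %| a)%Z); case: (boolP (2 %| b)%Z); case: (boolP (2 %| c)%Z);
  case: (boolP (2 %| d)%Z) => *; solve [constructor 1; lia | constructor 2; lia | constructor 3; lia | constructor 4; lia].
- by exists 0%N; do 4 eexists; split; first reflexivity; lia.
- by exists 1%N; do 4 eexists; split; first reflexivity; lia.
- by exists 2%N; do 4 eexists; split; first reflexivity; lia.
- by exists 3%N; do 4 eexists; split; first reflexivity; lia.
Qed.

(** Coordinates of equal parity mean divisibility by the square of the prime for k = 2, by its cube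
    for k = 3. Since [(1 + i) / 2] is the inverse of [1 - i], it removes one, respectively two, of
    these factors and leaves one. *)
Lemma half_step k a b c d : (1 < k)%N -> qlevel k (a, b, c, d) ->
  (2 %| a + b)%Z -> (2 %| b + c)%Z -> (2 %| c + d)%Z ->
  exists t', [/\ qlevel k t', qeven t' & (1 + im) / 2 * qv (a, b, c, d) = qv t'].
Proof.
move=> k1 kt ab bc cd.
have /dvdzP[x ex] : (2 %| a - c)%Z by lia.
have /dvdzP[y ey] : (2 %| b - d)%Z by lia.
have ea : a = c + x * 2 by lia.
have eb : b = d + y * 2 by lia.
exists (x, y, x + c, y + d); split.
- move: kt; rewrite /qlevel [(k <= 1)%N]leqNgt k1 /= !andbT; case: (k <= 2)%N => //=; lia.
- rewrite /qeven; lia.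
rewrite ea eb /qval; have ww := mul_ww R; have ii := mul_ii R; have t0 := two_neq0 R.
move: ww ii t0; generalize im (zeta R (2 ^ 3)) => i v ww ii t0.
by field: ww ii.
Qed.

(** The interface between a gate and the column reduction, shared by [H'] and [F4]. *)
Definition reduces k j (G : 'M[K]_j) := forall t : 'I_j -> quad,
  (forall u, qlevel k (t u)) -> (forall u, ~~ qeven (t u)) ->
  exists e : 'I_j -> nat, forall u, exists t', [/\ qlevel k t', qeven t' &
     \sum_u' G u u' * (zk k ^+ e u' * qv (t u')) = qv t'].

Lemma reduces_H k : (1 < k <= 3)%N -> reduces k (H'mx R).
Proof.
move=> hk t kt te; have /andP[k1 _] := hk.
pose u0 := ord2 1 0; pose u1 := ord2 1 1.
have [e0 [a [b [c [d [l0 E0 h1 h2 h3]]]]]] := odd_normal hk (kt u0) (te u0).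
have [e1 [a' [b' [c' [d' [l1 E1 h1' h2' h3']]]]]] := odd_normal hk (kt u1) (te u1).
exists (fun u => if u == u0 then e0 else e1) => u.
have -> : \sum_u' H'mx R u u' * (zk k ^+ (if u' == u0 then e0 else e1) * qv (t u')) =
   H'mx R u u0 * qv (a, b, c, d) + H'mx R u u1 * qv (a', b', c', d').
  rewrite [LHS]big_ord_recl big_ord_recl big_ord0 addr0 -E0 -E1.
  have -> : ord0 = u0 by exact: val_inj.
  have -> : lift u0 ord0 = u1 by exact: val_inj.
  by rewrite eqxx.
case: (eqVneq u u0) => [->|ne].
  have [t' [kt' t'e E]] := @half_step k (a + a') (b + b') (c + c') (d + d') k1
    (qlevel_add l0 l1) ltac:(lia) ltac:(lia) ltac:(lia).
  exists t'; split=> //; rewrite -E -[(a + a', _, _, _)]/(qadd (a, b, c, d) (a', b', c', d')) qval_add.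
  have e00 : H'mx R u0 u0 = (1 + im) / 2 by rewrite H'mxE mxE.
  have e01 : H'mx R u0 u1 = (1 + im) / 2 by rewrite H'mxE mxE.
  by rewrite e00 e01 [RHS]mulrDr.
have {ne} -> : u = u1 by case: u ne => -[|[|//]] ? ne; apply: val_inj.
have [t' [kt' t'e E]] := @half_step k (a - a') (b - b') (c - c') (d - d') k1
    (qlevel_add l0 (qlevel_opp l1)) ltac:(lia) ltac:(lia) ltac:(lia).
exists t'; split=> //; rewrite -E -[(a - a', _, _, _)]/(qadd (a, b, c, d) (qopp (a', b', c', d'))) qval_add qval_opp.
have e10 : H'mx R u1 u0 = (1 + im) / 2 by rewrite H'mxE mxE.
have e11 : H'mx R u1 u1 = - ((1 + im) / 2) by rewrite H'mxE mxE.
by rewrite e10 e11 [RHS]mulrDr [in LHS]mulNr [in RHS]mulrN.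
Qed.

(** Signs bring odd integers to 1 modulo 4. A row of [2 F4] has four plus signs or two of each kind,
    so its sum is divisible by 4 and half of it is still even. *)
Lemma reduces_F4 : reduces 1 (F4 R).
Proof.
move=> t kt te.
have h u : exists e q, (-1) ^+ e * qv (t u) = (4 * q + 1)%:~R.
  have := kt u; have := te u; case: (t u) => [[[a b] c] d] /= ae /andP[/andP[/eqP e1 /eqP e2] /eqP e3].
  rewrite e1 e2 e3 !addr0 in ae *; rewrite !mul0r !addr0.
  have [[q ->]|[q ->]] : (exists q, a = 4 * q + 1) \/ (exists q, a = - (4 * q + 1)).
  - case: (boolP (4 %| a - 1)%Z) => hh; [left; exists (a %/ 4)%Z; lia | right; exists (- (a + 1) %/ 4)%Z; lia].
  - by exists 0%N, q; rewrite expr0 mul1r.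
  - by exists 1%N, q; rewrite expr1 mulN1r rmorphN opprK.
have [e he] := fin_all_exists h; have [q hq] := fin_all_exists he.
exists e => u; rewrite zeta_2.
under eq_bigr => u' _ do rewrite hq.
pose s (u u' : 'I_4) : int := (-1) ^+ ((u %/ 2) * (u' %% 2) + (u %% 2) * (u' %/ 2))%N.
have [r hr] : exists r, \sum_u' s u u' * (4 * q u' + 1) = 4 * r.
  rewrite !big_ord_recl big_ord0 addr0.
  move: (q _) (q _) (q _) (q _) => q3 q2 q1 q0.
  case: u => -[|[|[|[|//]]]] ?; rewrite /s /= ?expr0 ?expr1 ?sqrrN ?expr1n ?mul1r ?mulN1r.
  - by exists (q0 + q1 + q2 + q3 + 1); ring.
  - by exists (q0 + q1 - q2 - q3); ring.
  - by exists (q0 - q1 + q2 - q3); ring.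
  - by exists (q0 - q1 - q2 + q3); ring.
exists (2 * r, 0, 0, 0); split; [by []|rewrite /qeven; lia|].
have t0 := two_neq0 R.
rewrite /= !mul0r !addr0; apply: (mulfI t0).
have -> : 2 * (2 * r)%:~R = (4 * r)%:~R :> K by ring.
rewrite -hr rmorph_sum mulr_sumr; apply: eq_bigr => u' _.
rewrite mxE rmorphM /= /s rmorphXn rmorphN rmorph1; by field.
Qed.

End Reduce.

(** * Descent on one column *)

Section Columns.
Variable R : realType.
Local Notation K := R[i].
Local Notation im := (imag R).
Local Notation qv := (@qval R).
Local Notation w := (zeta R (2 ^ 3)).

Definition nrm2 N (v : 'cV[K]_N) : K := \sum_x v x 0 * (v x 0)^*%C.

Lemma nrm2_unitary N (V : 'M[K]_N) v : unitary V -> nrm2 (V *m v) = nrm2 v.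
Proof.
move=> uV; have VV : adj V *m V = 1%:M by exact: mulmx1C uV.
pose ct (u : 'cV[K]_N) : 'rV[K]_N := \row_x (u x 0)^*%C.
have nE u : nrm2 u = (ct u *m u) 0 0.
  by rewrite mxE; apply: eq_bigr => x _; rewrite mxE mulrC.
have ctM : ct (V *m v) = ct v *m adj V.
  apply/rowP => x; rewrite !mxE rmorph_sum; apply: eq_bigr => y _.
  by rewrite !mxE rmorphM mulrC.
by rewrite !nE ctM mulmxA -(mulmxA (ct v)) VV mulmx1.
Qed.

Lemma sum_int_eq1 (I : finType) (F : I -> int) : (forall x, 0 <= F x) -> \sum_x F x = 1 ->
  exists2 y, F y = 1 & forall x, x != y -> F x = 0.
Proof.
move=> F0 s1; have [y Fy] : exists y, F y != 0.
  apply/existsP; apply: contra_eqT s1 => /existsPn h.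
  by rewrite big1 // => x _; apply/eqP; have := h x; rewrite negbK.
have S0 : 0 <= \sum_(i | i != y) F i by apply: sumr_ge0.
rewrite (bigD1 y) //= in s1; have y0 := F0 y.
have [y1 s0] : F y = 1 /\ \sum_(i | i != y) F i = 0.
  by move: (\sum_(i | i != y) F i) s1 S0 => S; lia.
exists y => // x xy; have h := psumr_eq0P (fun i _ => F0 i) s0; exact: h xy.
Qed.

Lemma qsq_eq0 t : qsq t = 0 -> t = (0, 0, 0, 0).
Proof.
move: t => [[[a b] c] d] /= h.
have a0 : a = 0 by nia. have b0 : b = 0 by nia. have c0 : c = 0 by nia. have d0 : d = 0 by nia.
by rewrite a0 b0 c0 d0.
Qed.

(** Exactly one coordinate is nonzero and it is 1 or -1. *)
Lemma qsq_eq1 k t : (0 < k <= 3)%N -> qlevel k t -> qsq t = 1 ->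
  exists e, qv t = zeta R (2 ^ k) ^+ e.
Proof.
move=> hk; have ww := mul_ww R; have ii := mul_ii R.
have z2 : zeta R (2 ^ 2) = im by rewrite -(zeta_4 R).
have z1 : zeta R (2 ^ 1) = -1 by exact: zeta_2.
move: t => [[[a b] c] d] kt; rewrite /qsq => h.
have : a * a <= 1 by nia. have : b * b <= 1 by nia.
have : c * c <= 1 by nia. have : d * d <= 1 by nia.
have sm (x : int) : x * x <= 1 -> [\/ x = 0, x = 1 | x = -1].
  have : [\/ x = 0, x = 1, x = -1 | 1 < `|x|] by case: x => [[|[|n]]|[|n]]; [constructor 1|constructor 2|constructor 4|constructor 3|constructor 4].
  by case; [constructor 1|constructor 2|constructor 3|nia].
move=> /sm hd /sm hc /sm hb /sm ha.
have {hk} : [\/ k = 1%N, k = 2%N | k = 3%N].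
  by case: k hk {kt} => [|[|[|[|//]]]] // _; [constructor 1|constructor 2|constructor 3].
case: ha h kt => ->; case: hb => ->; case: hc => ->; case: hd => -> h; try (exfalso; lia);
  move=> kt kE; case: kE kt => -> //= _; rewrite ?z1 ?z2; move: ww ii;
  generalize im w => i v ww ii;
  first [by exists 0%N; ring: ww ii | by exists 1%N; ring: ww ii | by exists 2%N; ring: ww ii
       | by exists 3%N; ring: ww ii | by exists 4%N; ring: ww ii | by exists 5%N; ring: ww ii
       | by exists 6%N; ring: ww ii | by exists 7%N; ring: ww ii].
Qed.

Lemma pi_pow k s : (0 < k <= 3)%N ->
  exists p, [/\ qlevel k p, (0 < s)%N ==> qeven p & qv (qpi k) ^+ s = qv p].
Proof.
move=> hk; elim: s => [|s [p [kp _ E]]].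
  by exists (qint 1); rewrite qlevel_int qval_int expr0.
exists (qmul (qpi k) p); split=> //=; first exact: qlevel_mul (qlevel_pi hk) kp.
  exact: qeven_mul_pi.
by rewrite qval_mul -E exprS.
Qed.

Section Column.
Variables (k m j : nat) (G : 'M[K]_(2 ^ j)).
Hypotheses (hk : (0 < k <= 3)%N) (m0 : (0 < m)%N) (hJ : qgroup k = (2 ^ j)%N).
Hypothesis hred : reduces k G.
Local Notation syn := (@synth R k m).
Local Notation zk := (zeta R (2 ^ k)).
Local Notation pik := (qv (qpi k)).
Hypothesis hsyn : forall a : 'I_(2 ^ j) -> 'I_(2 ^ m), injective a ->
  exists2 V, syn V & acts_on G a V.

Lemma synth_phases (g : 'I_(2 ^ m) -> nat) : syn (dmx (fun x => zk ^+ g x)).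
Proof.
have eqs A B : A = B -> syn A -> syn B by move=> ->.
have h (s : seq 'I_(2 ^ m)) : uniq s -> syn (dmx (fun x => if x \in s then zk ^+ g x else 1)).
  elim: s => [_|y s IH /= /andP[ys us]].
    by rewrite dmx1; [exact: synth1|move=> x; rewrite in_nil].
  have hy : syn (dmx (fun x => if x == y then zk ^+ g y else 1)).
    by apply: synth_phase => //; exists (g y).
  have := synth_mul hy (IH us); rewrite dmx_mul => H; apply: (eqs _ _ _ H); apply: eq_dmx => x.
  rewrite inE; case: eqP => [->|_] /=; first by rewrite (negbTE ys) mulr1.
  by rewrite mul1r.
have H := h _ (enum_uniq 'I_(2 ^ m)); apply: (eqs _ _ _ H); apply: eq_dmx => x; by rewrite mem_enum.
Qed.

Lemma acts_on_fix (a : 'I_(2 ^ j) -> 'I_(2 ^ m)) V (v : 'cV[K]_(2 ^ m)) : acts_on G a V ->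
  (forall u, v (a u) 0 = 0) -> V *m v = v.
Proof.
move=> [h1 h2] v0; apply/colP => x.
have [/codomP[u ->]|xa] := boolP (x \in codom a); last exact: h2.
by rewrite h1 v0 big1 // => u' _; rewrite v0 mulr0.
Qed.

(* Each step makes a group of [2 ^ j] odd numerators even; once all are even, [s] drops. *)
Lemma column (F : pred 'I_(2 ^ m)) s c (v : 'cV[K]_(2 ^ m)) t : nrm2 v = 1 ->
  (forall x, qlevel k (t x)) -> (forall x, pik ^+ s * v x 0 = qv (t x)) ->
  (forall x, F x -> v x 0 = 0) -> (#|[pred x | ~~ qeven (t x)]| <= c)%N ->
  exists V y e, [/\ syn V, forall x, F x -> V *m delta_mx x 0 = delta_mx x 0 :> 'cV_(2 ^ m) &
    V *m v = zk ^+ e *: delta_mx y 0].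
Proof.
elim: s c v t => [|s IHs] c.
  move=> v t nv kt tv _ _.
  have sq1 : \sum_x qsq (t x) = qsq (qint 1).
    apply: (@sum_norm_qsq R); rewrite qval_int conjc_int mulr1z mulr1 -nv.
    by apply: eq_bigr => x _; rewrite -tv expr0 mul1r.
  have [y ty t0] := sum_int_eq1 (fun x => qsq_ge0 (t x)) sq1.
  have [e he] := qsq_eq1 hk (kt y) ty.
  exists 1%:M, y, e; split; [exact: synth1|by move=> x _; rewrite mul1mx|].
  rewrite mul1mx; apply/colP => x; rewrite !mxE (_ : v x 0 = qv (t x)); last by rewrite -tv expr0 mul1r.
  have [->|ne] := eqVneq x y; first by rewrite he !eqxx mulr1.
  by rewrite (qsq_eq0 (t0 x ne)) andFb mulr0; exact: (qval_int R 0).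
have all_even (v : 'cV[K]_(2 ^ m)) t : nrm2 v = 1 ->
  (forall x, qlevel k (t x)) -> (forall x, pik ^+ s.+1 * v x 0 = qv (t x)) ->
  (forall x, F x -> v x 0 = 0) -> (forall x, qeven (t x)) ->
  exists V y e, [/\ syn V, forall x, F x -> V *m delta_mx x 0 = delta_mx x 0 :> 'cV_(2 ^ m) &
    V *m v = zk ^+ e *: delta_mx y 0].
  move=> nv kt tv Fv te.
  have [t' kt' ht'] := fin_all_exists2 (fun x => qdiv_pi hk (kt x) (te x)).
  (* Division by the prime may create new odd numerators, so the bound on their number is reset;
     hence the nested inductions. *)
  apply: (IHs _ v t' nv kt' _ Fv (leqnn _)) => x.
  apply: (mulfI (qval_pi_neq0 R hk)).
  by rewrite mulrA -exprS tv ht' qval_mul.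
elim: c => [|c IHc] v t nv kt tv Fv todd.
  apply: (all_even v t) => // x.
  by move: todd; rewrite leqn0 => /eqP/card0_eq h; have := h x; rewrite !inE => /negbFE.
have [/forallP te|/forallPn[x0 ox0]] := boolP [forall x, qeven (t x)]; first exact: (all_even v t).
set O := [pred x | ~~ qeven (t x)] in todd.
have [p [kp /= pe pE]] := pi_pow s.+1 hk.
have sqp : \sum_x qsq (t x) = qsq p.
  apply: (@sum_norm_qsq R); rewrite -pE -[RHS]mulr1 -nv /nrm2 mulr_sumr.
  by apply: eq_bigr => x _; rewrite -tv conjcM; ring.
(* Modulo [2 ^ j] the sum of the [qsq (t x)] counts the odd numerators. It equals [qsq p], which
   vanishes there because [p], a positive power of the prime, is even. *)
have dvdO : (2 ^ j %| #|O|)%N.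
  have : ((2 ^ j)%N %| \sum_x (qsq (t x) - (~~ qeven (t x))%:Z))%Z.
    by apply: rpred_sum => x _; rewrite -hJ; exact: qsq_mod.
  rewrite sumrB sqp rpredBl; last by rewrite -hJ; exact: qsq_even.
  rewrite (_ : \sum_x _ = (#|O|%:Z)); first by [].
  rewrite -[RHS]natz -sum1_card natr_sum [RHS]big_mkcond /=; apply: eq_bigr => x _.
  by rewrite inE; case: (qeven _).
have leO : (2 ^ j <= #|O|)%N.
  by apply: dvdn_leq => //; apply/card_gt0P; exists x0.
pose a (u : 'I_(2 ^ j)) : 'I_(2 ^ m) := enum_val (widen_ord leO u).
have aO u : ~~ qeven (t (a u)) by have := enum_valP (widen_ord leO u).
have ai : injective a.
  by move=> u u' /enum_val_inj /(congr1 val) /= e; apply: val_inj.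
have [e he] := hred (fun u => kt (a u)) aO.
have [V sV aV] := hsyn ai.
pose g x := if [pick u | a u == x] is Some u then e u else 0%N.
have ga u : g (a u) = e u.
  rewrite /g; case: pickP => [u' /eqP /ai -> //|/(_ u)]; by rewrite eqxx.
have gn x : x \notin codom a -> g x = 0%N.
  rewrite /g; case: pickP => // u /eqP <-; by rewrite codom_f.
set D := dmx (fun x => zk ^+ g x).
have sD : syn D by exact: synth_phases.
have evn x : exists t' : quad,
    [/\ qlevel k t', pik ^+ s.+1 * (V *m (D *m v)) x 0 = qv t',
        qeven (t x) -> qeven t' & x \in codom a -> qeven t'].
  have [/codomP[u ->]|xa] := boolP (x \in codom a).
    have [t' [kt' te' E]] := he u; exists t'; split=> //.
    rewrite (aV.1) mulr_sumr -E; apply: eq_bigr => u' _.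
    by rewrite dmx_mulv ga -tv; ring.
  exists (t x); split=> //.
  by rewrite (aV.2) // dmx_mulv gn // expr0 mul1r.
have [t' ht'] := fin_all_exists evn.
(* The numerator at a level of [F] is 0, hence even, so such a level is never chosen in a group. *)
have Fa x u : F x -> x != a u.
  move=> Fx; apply: contraTneq (aO u) => <-.
  have := tv x; rewrite Fv // mulr0 => /esym /qval_eq0 ->; by [].
have fixF x : F x -> V *m (D *m delta_mx x 0) = delta_mx x 0 :> 'cV_(2 ^ m).
  move=> Fx; have -> : D *m delta_mx x 0 = delta_mx x 0 :> 'cV_(2 ^ m).
    apply/colP => y; rewrite dmx_mulv !mxE; have [->|_] := eqVneq y x; last by rewrite mulr0.
    by rewrite gn ?mul1r //; apply/codomP => -[u /eqP]; rewrite (negbTE (Fa x u Fx)).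
  by apply: (acts_on_fix aV) => u; rewrite mxE eq_sym (negbTE (Fa x u Fx)).
have nv' : nrm2 (V *m (D *m v)) = 1.
  by rewrite !nrm2_unitary //; [exact: sD.1|exact: sV.1].
have [||||W [y [r [sW fW eW]]]] := IHc _ t' nv' _ _ _ _.
- by move=> x; have [] := ht' x.
- by move=> x; have [] := ht' x.
- move=> x Fx; rewrite (aV.2); last by apply/codomP => -[u /eqP]; rewrite (negbTE (Fa x u Fx)).
  by rewrite dmx_mulv Fv // mulr0.
- rewrite -ltnS; apply: leq_trans todd; apply: proper_card; apply/properP; split.
    apply/subsetP => x; rewrite !inE; apply: contra; by have [] := ht' x.
  exists (a (ord2 j 0)); rewrite !inE ?aO // negbK; have [_ _ _] := ht' (a (ord2 j 0)).
  by apply; rewrite codom_f.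
exists (W *m (V *m D)), y, r; split; first by do 2?apply: synth_mul.
  by move=> x Fx; rewrite -!mulmxA fixF // fW.
by rewrite -!mulmxA eW.
Qed.

End Column.
End Columns.

(** * Induction over the columns *)

Section Base.
Variable R : realType.
Local Notation K := R[i].
Local Notation qv := (@qval R).

Section Induction.
Variables (k m j : nat) (G : 'M[K]_(2 ^ j)).
Hypotheses (hk : (0 < k <= 3)%N) (m0 : (0 < m)%N) (hJ : qgroup k = (2 ^ j)%N).
Hypothesis hred : reduces k G.
Local Notation syn := (@synth R k m).
Local Notation zk := (zeta R (2 ^ k)).
Local Notation pik := (qv (qpi k)).
Hypothesis hsyn : forall a : 'I_(2 ^ j) -> 'I_(2 ^ m), injective a ->
  exists2 V, syn V & acts_on G a V.

Lemma common_denom N (v : 'I_N -> K) : (forall x, in_Zhalf zk (v x)) ->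
  exists s (t : 'I_N -> quad), forall x, qlevel k (t x) /\ pik ^+ s * v x = qv (t x).
Proof.
move=> zv; have [s hs] := fin_all_exists (fun x => Zh_denom hk (zv x)).
have h x : exists t, qlevel k t /\ pik ^+ (\sum_x s x)%N * v x = qv t.
  have [t [kt E]] := hs x.
  have [p [kp _ Ep]] := pi_pow R (\sum_(y | y != x) s y) hk.
  exists (qmul p t); split; first exact: qlevel_mul.
  by rewrite (bigD1 x) //= addnC exprD qval_mul -Ep -E mulrA.
have [t ht] := fin_all_exists h; by exists (\sum_x s x)%N, t.
Qed.

(** The descent ends at an uncontrolled position [y] and phase; a one-level phase and a
    transposition bring the result to [i0]. *)
Lemma basis_column (F : pred 'I_(2 ^ m)) (v : 'cV[K]_(2 ^ m)) i0 : nrm2 v = 1 ->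
  (forall x, in_Zhalf zk (v x 0)) -> (forall x, F x -> v x 0 = 0) -> ~~ F i0 ->
  exists2 V, syn V & (forall x, F x -> V *m delta_mx x 0 = delta_mx x 0 :> 'cV_(2 ^ m)) /\
    V *m v = delta_mx i0 0.
Proof.
move=> nv zv Fv Fi0; have [s [t ht]] := common_denom zv.
have [V [y [e [sV fV eV]]]] := column hk m0 hJ hred hsyn nv
  (fun x => (ht x).1) (fun x => (ht x).2) Fv (leqnn _).
(* If [y] were a fixed level, inverting [V] would make [v] a nonzero multiple of that basis vector,
   although [v] vanishes on [F]. *)
have Fy : ~~ F y.
  apply/negP => Fy; have VV : adj V *m V = 1%:M by apply: mulmx1C; exact: sV.1.
  have ev : v = zk ^+ e *: delta_mx y 0.
    by rewrite -[LHS]mul1mx -VV -mulmxA eV -scalemxAr -(fV y Fy) mulmxA VV mul1mx fV.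
  have := Fv y Fy; rewrite ev !mxE !eqxx mulr1 => /eqP.
  by rewrite expf_eq0 (negbTE (zeta_neq0 _ _)) andbF.
have [r er] : exists r, zk ^+ r * zk ^+ e = 1.
  exists (e * (2 ^ k).-1)%N; rewrite -exprD -mulnSr prednK ?exp2_gt0 // mulnC exprM.
  by case: (k) hk => // k' _; rewrite zeta_order expr1n.
pose D := dmx (fun x => if x == y then zk ^+ r else 1).
have sD : syn D by apply: synth_phase => //; exists r.
pose T := pmx K (tperm y i0); have sT : syn T by exact: synth_perm.
exists (T *m (D *m V)); first by do 2?apply: synth_mul.
have DE x : D *m delta_mx x 0 = (if x == y then zk ^+ r else 1) *: delta_mx x 0 :> 'cV_(2 ^ m).
  apply/colP => i; rewrite dmx_mulv !mxE; have [->//|_] := eqVneq i x.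
  by rewrite !mulr0.
have TE x : T *m delta_mx x 0 = delta_mx (tperm y i0 x) 0 :> 'cV_(2 ^ m).
  apply/colP => i; rewrite (pmx_mull _ _ _ (permK _) (permKV _)) !mxE.
  by rewrite tpermV -{2}(tpermK y i0 x) -[in RHS](inj_eq (@perm_inj _ (tperm y i0))) !tpermK.
split=> [x Fx|]; rewrite -!mulmxA.
  rewrite fV // DE; case: eqP => [e'|_]; first by rewrite -e' Fx in Fy.
  rewrite scale1r TE tpermD //; first by apply: contraNneq Fy => ->.
  by apply: contraNneq Fi0 => ->.
by rewrite eV -scalemxAr DE eqxx scalerA mulrC er scale1r TE tpermL.
Qed.

Lemma synth_of_entries (U : 'M[K]_(2 ^ m)) : unitary U ->
  (forall x y, in_Zhalf zk (U x y)) -> syn U.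
Proof.
move=> uU zU; have k0 : (0 < k)%N by case/andP: hk.
(* [r] bounds the number of columns not yet reduced; all columns before the last [r] are
   standard. *)
suff H r : forall U : 'M[K]_(2 ^ m), unitary U -> (forall x y, in_Zhalf zk (U x y)) ->
    (forall i : 'I_(2 ^ m), (i + r < 2 ^ m)%N -> U *m delta_mx i 0 = delta_mx i 0 :> 'cV_(2 ^ m)) -> syn U.
  by apply: (H (2 ^ m)%N) => // i; rewrite ltnNge leq_addl.
elim: r {U uU zU} => [|r IH] U uU zU fU.
  have -> : U = 1%:M; last exact: synth1.
  apply/matrixP => x y; have := fU y; rewrite addn0 => /(_ (ltn_ord y)).
  by rewrite -colE => /colP /(_ x); rewrite !mxE andbT.
have [hr|hr] := ltnP r (2 ^ m); last first.
  apply: IH => // i; by rewrite ltnNge (leq_trans hr (leq_addl _ _)).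
have i0P : (2 ^ m - r.+1 < 2 ^ m)%N by rewrite ltn_subrL exp2_gt0.
pose i0 : 'I_(2 ^ m) := Ordinal i0P.
pose v := U *m delta_mx i0 0 : 'cV_(2 ^ m).
have UU : adj U *m U = 1%:M by exact: mulmx1C uU.
have vE x : v x 0 = U x i0 by rewrite /v -colE mxE.
have colF (i : 'I_(2 ^ m)) : (i < i0)%N -> U *m delta_mx i 0 = delta_mx i 0 :> 'cV_(2 ^ m).
  by move=> /= hi; apply: fU; lia.
have vF (x : 'I_(2 ^ m)) : (x < i0)%N -> v x 0 = 0.
  move=> hx; have Ux y : U y x = (y == x)%:R.
    by have /colP /(_ y) := colF x hx; rewrite -colE !mxE andbT.
  rewrite vE; have /matrixP /(_ x i0) := UU; rewrite !mxE (bigD1 x) //= big1 => [|y ne].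
    rewrite !mxE Ux eqxx conjc1 mul1r addr0 => ->.
    by case: eqP hx => [<-|//]; rewrite ltnn.
  by rewrite !mxE Ux (negbTE ne) conjc0 mul0r.
have nv : nrm2 v = 1.
  rewrite (nrm2_unitary _ uU) /nrm2 (bigD1 i0) //= big1 => [|y ne].
    by rewrite !mxE !eqxx conjc1 mulr1 addr0.
  by rewrite !mxE (negbTE ne) mul0r.
have [|||V sV [fV eV]] := @basis_column (fun x => (x < i0)%N) v i0 nv.
- by move=> x; rewrite vE.
- exact: vF.
- by rewrite ltnn.
(* Necessity, applied to the circuit just built, keeps the entries of [V *m U] in the ring. *)
have zV := Zh_rep k0 sV.2.
have sVU : syn (V *m U).
  apply: IH => [||i hi]; first exact: unitary_mul sV.1 uU.
    exact: Zh_mulmx.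
  rewrite -mulmxA; have [ii|ii] := ltnP i i0; first by rewrite colF // fV.
  have -> : i = i0 by apply: val_inj => /=; move: ii hi hr => /=; lia.
  exact: eV.
have VaV : V *m adj V = 1%:M by exact: sV.1.
have -> : U = adj V *m (V *m U) by rewrite mulmxA (mulmx1C VaV) mul1mx.
apply: synth_mul sVU; exact: synth_inv VaV sV.
Qed.

End Induction.

Lemma synth_base k m (U : 'M[K]_(2 ^ m)) : (0 < k <= 3)%N -> (0 < m)%N -> unitary U ->
  (forall x y, in_Zhalf (zeta R (2 ^ k)) (U x y)) -> synth k U.
Proof.
move=> hk m0 uU zU; have [k1|k1] := eqVneq k 1%N.
  rewrite k1 in zU *; apply: (synth_of_entries (j := 2) (G := F4 R)) => //.
    exact: reduces_F4.
  move=> a ai; apply: synth_four_level => //.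
  (* Four distinct levels force [m >= 2]; for [m = 1] there is no injective [a] to treat. *)
  by have := max_card (mem (codom a)); rewrite card_codom // !card_ord; case: m m0 {U uU zU a ai} => [|[|m]].
have hk' : (1 < k <= 3)%N by move: hk k1; lia.
apply: (synth_of_entries (j := 1) (G := H'mx R)) => //.
- by rewrite /qgroup (negbTE k1).
- exact: reduces_H.
- by move=> a ai; exact: synth_two_level.
Qed.

End Base.

(** * Catalytic embedding *)

Section LastQubit.
Variable m : nat.
Local Notation f := (single (ord_max : 'I_m.+1)).
Local Notation wid := (widen_ord (leqnSn m)).

Definition high (x : 'I_(2 ^ m.+1)) : 'I_(2 ^ m) := of_bits (fun q => qbit x (wid q)).
Definition low (x : 'I_(2 ^ m.+1)) : 'I_(2 ^ 1) := loc f x.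
(** This is [pad 1] with a result indexed by [m.+1], which is not convertible to [m + 1]. *)
Definition append0 (y : 'I_(2 ^ m)) : 'I_(2 ^ m.+1) := ord2 m.+1 (y * 2).
Definition append y u : 'I_(2 ^ m.+1) := upd f (append0 y) u.

Lemma val_append0 y : val (append0 y) = (y * 2)%N.
Proof. by rewrite /= modn_small // expnSr ltn_pmul2r. Qed.

Lemma high_append0 y : high (append0 y) = y.
Proof.
apply: qbit_inj => q; rewrite of_bitsK /qbit -[nat_of_ord (append0 y)]/(val (append0 y)) val_append0 /=.
have -> : (m - q = (m.-1 - q) + 1)%N by have := ltn_ord q; lia.
by rewrite expnD divnMr.
Qed.

Lemma low_append0 y : low (append0 y) = ord2 1 0.
Proof.
apply: qbit_inj => q; rewrite qbit_loc ord1.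
rewrite /qbit -[nat_of_ord (append0 y)]/(val (append0 y)) val_append0 /= subnn expn0 divn1.
by rewrite muln2 odd_double.
Qed.

Lemma wid_max q : wid q \notin codom f.
Proof.
by apply/codomP => -[s /(congr1 val)] /= e; have := ltn_ord q; rewrite e ltnn.
Qed.

Lemma agree_high x y : agree f x y = (high x == high y).
Proof.
apply/agreeP/eqP => [h|e q qf].
  by apply: qbit_inj => q; rewrite !of_bitsK h // wid_max.
have qm : (q < m)%N.
  rewrite ltn_neqAle -ltnS ltn_ord andbT; apply: contra qf => /eqP e'.
  by rewrite (_ : q = f ord0) ?codom_f //; apply: val_inj.
have -> : q = wid (Ordinal qm) by apply: val_inj.
by have := congr1 (fun z => qbit z (Ordinal qm)) e; rewrite !of_bitsK.
Qed.

Lemma high_append y u : high (append y u) = y.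
Proof. by apply/eqP; rewrite -{2}(high_append0 y) -agree_high agree_sym agree_upd. Qed.

Lemma low_append y u : low (append y u) = u.
Proof. exact: (loc_upd (@single_inj _ _)). Qed.

Lemma high_low_inj x y : high x = high y -> low x = low y -> x = y.
Proof. by move=> /eqP; rewrite -agree_high => h1 h2; exact: (agree_loc_inj h1 h2). Qed.

Lemma sum_append (V : nmodType) (F : 'I_(2 ^ m.+1) -> V) :
  \sum_x F x = \sum_y \sum_u F (append y u).
Proof.
rewrite pair_bigA /= (reindex (fun p : 'I_(2 ^ m) * 'I_(2 ^ 1) => append p.1 p.2)) //.
exists (fun x => (high x, low x)) => [[y u] _|x _] /=; first by rewrite high_append low_append.
by apply: high_low_inj; rewrite ?high_append ?low_append.
Qed.

Section Tensor.
Variable R : realType.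
Local Notation K := R[i].

Definition tens (A : 'M[K]_(2 ^ m)) (L : 'M[K]_(2 ^ 1)) : 'M[K]_(2 ^ m.+1) :=
  \matrix_(x, y) (A (high x) (high y) * L (low x) (low y)).

Lemma tens_mul A B L M : tens A L *m tens B M = tens (A *m B) (L *m M).
Proof.
apply/matrixP => x y; rewrite !mxE sum_append mulr_suml; apply: eq_bigr => z _.
rewrite mulr_sumr; apply: eq_bigr => u _; rewrite !mxE high_append low_append; ring.
Qed.

Lemma tens1 : tens 1%:M 1%:M = 1%:M.
Proof.
apply/matrixP => x y; rewrite !mxE.
have [->|ne] := eqVneq x y; first by rewrite !eqxx mulr1.
have [h|] := eqVneq (high x) (high y); last by rewrite mul0r.
have [h'|] := eqVneq (low x) (low y); last by rewrite mulr0.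
by case/eqP: ne; apply: high_low_inj.
Qed.

Lemma adj_tens A L : adj (tens A L) = tens (adj A) (adj L).
Proof. by apply/matrixP => x y; rewrite !mxE conjcM. Qed.

(* The matrix of [u |-> u (x) l]. *)
Definition attach (l : 'I_(2 ^ 1) -> K) : 'M[K]_(2 ^ m.+1, 2 ^ m) :=
  \matrix_(x, y) ((high x == y)%:R * l (low x)).

Lemma tens_attach A L l x y :
  (tens A L *m attach l) x y = A (high x) y * \sum_u L (low x) u * l u.
Proof.
rewrite mxE sum_append (bigD1 y) //= [X in _ + X]big1 ?addr0 => [|z ne].
  by rewrite mulr_sumr; apply: eq_bigr => u _; rewrite !mxE high_append low_append eqxx mul1r mulrA.
by apply: big1 => u _; rewrite !mxE high_append (negbTE ne) mul0r mulr0.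
Qed.

Lemma attach_mul l (U : 'M[K]_(2 ^ m)) x y : (attach l *m U) x y = U (high x) y * l (low x).
Proof.
rewrite mxE (bigD1 (high x)) //= !mxE eqxx mul1r mulrC big1 ?addr0 // => z ne.
by rewrite !mxE eq_sym (negbTE ne) !mul0r.
Qed.

Lemma gmux_append0 (G : 'M[K]_(2 ^ 1)) :
  gmux f (fun=> G) *m pmx K append0 = attach (fun u => G u (ord2 1 0)).
Proof.
apply/matrixP => x y; rewrite pmx_mulr !mxE agree_high high_append0 -[loc f (append0 y)]/(low _) low_append0.
by case: eqP => _; rewrite ?mul1r ?mul0r.
Qed.

End Tensor.
End LastQubit.

(** * Lowering k at the cost of one ancilla *)

Section Catalysis.
Variable R : realType.
Local Notation K := R[i].

Lemma gateset_incl k n C : (2 < k)%N -> circuit (gateset R k) n C -> circuit (gateset R k.+1) n C.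
Proof.
move=> k2; have k3 : (2 < k.+1)%N by exact: ltnW.
have k1 : (1 < k.+1)%N by exact: ltnW.
have av g : List.In g (gateset R k) -> avail (gateset R k.+1) (gmat g).
  rewrite gateset3 //= => -[<-|[<-|[<-|[<-|//]]]] /=.
  - exact: (avail_H R k1).
  - by rewrite phase_mxE; exact: (avail_S R k1).
  - by have [] := gateset_classical R (isT : 0 < k.+1)%N.
  - by rewrite phase_mxE -(zeta_exp2S R k); apply: avail_phase_exp; exact: (avail_T R k3).
elim=> [|g f M gin fi _ IH]; first exact: circ_nil.
by apply: circuit_mul IH; exact: av.
Qed.

Variable k : nat.
Hypothesis k2 : (2 < k)%N.
Local Notation z := (zeta R (2 ^ k.+1)).
Local Notation eta := (zeta R (2 ^ k)).
Local Notation Zh := (in_Zhalf eta).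

Lemma Zh_split x : in_Zhalf z x -> exists a b, [/\ Zh a, Zh b & x = a + z * b].
Proof.
elim=> [|||y y' _ [a [b [ha hb ->]]] _ [a' [b' [ha' hb' ->]]]|y _ [a [b [ha hb ->]]]|
        y y' _ [a [b [ha hb ->]]] _ [a' [b' [ha' hb' ->]]]].
- by exists 1, 0; split; [exact: Zh_one|exact: Zh0|ring].
- by exists (2^-1), 0; split; [exact: Zh_half|exact: Zh0|ring].
- by exists 0, 1; split; [exact: Zh0|exact: Zh_one|ring].
- by exists (a + a'), (b + b'); split; [exact: Zh_add|exact: Zh_add|ring].
- by exists (- a), (- b); split; [exact: Zh_opp|exact: Zh_opp|ring].
- exists (a * a' + eta * (b * b')), (a * b' + b * a'); split.
  + by apply: Zh_add; [exact: Zh_mul|apply: Zh_mul; [exact: Zh_gen|exact: Zh_mul]].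
  + by apply: Zh_add; exact: Zh_mul.
  + by rewrite -(zeta_exp2S R k); ring.
Qed.

Lemma Zh_poly x : Zh x -> exists p : {poly rat}, x = (map_poly ratr p).[eta].
Proof.
elim=> [|||y y' _ [p ->] _ [q ->]|y _ [p ->]|y y' _ [p ->] _ [q ->]].
- by exists 1; rewrite rmorph1 hornerC.
- by exists (2^-1)%:P; rewrite map_polyC hornerC /= fmorphV rmorph_nat.
- by exists 'X; rewrite map_polyX hornerX.
- by exists (p + q); rewrite rmorphD hornerD.
- by exists (- p); rewrite rmorphN hornerN.
- by exists (p * q); rewrite rmorphM hornerM.
Qed.

(** The relation says that a rational polynomial, even part [p] and odd part [q], vanishes at [z].
    It then vanishes at [-z], so [a - z b] is 0 as well. *)
Lemma Zh_indep a b : Zh a -> Zh b -> a + z * b = 0 -> a = 0 /\ b = 0.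
Proof.
move=> /Zh_poly[p pE] /Zh_poly[q qE] ab0.
pose P := p \Po 'X^2 + 'X * (q \Po 'X^2).
have PE x : (map_poly (ratr : rat -> K) P).[x] =
    (map_poly ratr p).[x ^+ 2] + x * (map_poly ratr q).[x ^+ 2].
  rewrite rmorphD rmorphM /= hornerD hornerM map_polyX hornerX !map_comp_poly map_polyXn.
  by rewrite !horner_comp hornerXn.
have := @zeta_conj_root R k P (ltnW (ltnW k2)).
rewrite !rootE !PE sqrrN zeta_exp2S -pE -qE ab0 eqxx => /(_ isT) /eqP; rewrite mulNr => ab1.
have t0 := two_neq0 R.
have a0 : a = 0.
  apply: (mulfI t0); rewrite mulr0.
  have -> : 2 * a = (a + z * b) + (a - z * b) by ring.
  by rewrite ab0 ab1 addr0.
split=> //; apply: (mulfI (zeta_neq0 R (2 ^ k.+1))).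
by move: ab0; rewrite a0 add0r mulr0.
Qed.

Lemma Zh_conj x : Zh x -> Zh x^*%C.
Proof.
elim=> [|||y y' _ h _ h'|y _ h|y y' _ h _ h'].
- by rewrite conjc1; exact: Zh_one.
- by rewrite conjc_inv conjc_nat; exact: Zh_half.
- have -> : eta^*%C = eta ^+ (2 ^ k).-1.
    apply: (mulfI (zeta_neq0 R (2 ^ k))); rewrite zeta_conj -exprS prednK ?exp2_gt0 //.
    by case: (k) k2 => // k' _; rewrite zeta_order.
  by apply: Zh_exp; exact: Zh_gen.
- by rewrite (_ : (y + y')^*%C = y^*%C + y'^*%C); [exact: Zh_add|exact: rmorphD].
- by rewrite (_ : (- y)^*%C = - y^*%C); [exact: Zh_opp|exact: rmorphN].
- by rewrite conjcM; exact: Zh_mul.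
Qed.

Local Notation L := (mx2 0 1 eta 0).

(* [phi (A + z B) = A (x) 1 + B (x) L], with [L] a square root of [eta]. *)
Lemma embed_unitary m (A B : 'M[K]_(2 ^ m)) :
  (forall x y, Zh (A x y)) -> (forall x y, Zh (B x y)) ->
  unitary (A + z *: B) -> unitary (tens A 1%:M + tens B L).
Proof.
move=> zA zB; rewrite /unitary -!/(adj _) => uU.
have adjD (n : nat) (M N : 'M[K]_n) : adj (M + N) = adj M + adj N.
  by apply/matrixP => x y; rewrite !mxE rmorphD.
have adjZ (n : nat) c (M : 'M[K]_n) : adj (c *: M) = c^*%C *: adj M.
  by apply/matrixP => x y; rewrite !mxE rmorphM.
have zz := zeta_conj R (2 ^ k.+1); have ee := zeta_conj R (2 ^ k).
have zc : z^*%C = z * eta^*%C.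
  by rewrite -(zeta_exp2S R k) expr2 conjcM mulrA zz mul1r.
have adj_mx2 (a b c d : K) : adj (mx2 a b c d) = mx2 a^*%C c^*%C b^*%C d^*%C.
  by apply/matrixP => -[[|[|//]] ?] [[|[|//]] ?]; rewrite !mxE.
have scale_mx2 (e a b c d : K) : e *: mx2 a b c d = mx2 (e * a) (e * b) (e * c) (e * d).
  by apply/matrixP => -[[|[|//]] ?] [[|[|//]] ?]; rewrite !mxE.
(* The same relation to its adjoint as [zc] gives between [z] and its conjugate; with [LL] it lets
   [L] stand in for [z] in the unitarity equation. *)
have adjL : adj L = eta^*%C *: L.
  by rewrite adj_mx2 scale_mx2 !conjc0 conjc1 !mulr0 mulr1 [_^*%C * _]mulrC ee.
have LL : L *m adj L = 1%:M.
  rewrite adj_mx2 conjc0 conjc1 mx2_mul -mx2_1 ee; apply: mx2_eqP; ring.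
have zadj (M : 'M[K]_(2 ^ m)) : (forall x y, Zh (M x y)) -> forall x y, Zh (adj M x y).
  by move=> zM x y; rewrite mxE; exact: Zh_conj.
(* The components of [U *m adj U - 1] along 1 and [z]; rewriting the conjugate of [z] by [zc] keeps
   both over the smaller ring. *)
pose P := A *m adj A + B *m adj B - 1%:M.
pose Q := B *m adj A + eta^*%C *: (A *m adj B).
have PQ x y : P x y = 0 /\ Q x y = 0.
  apply: Zh_indep.
  - rewrite !mxE; apply: Zh_add; last by apply: Zh_opp; exact: Zh_bool.
    by apply: Zh_add; apply: Zh_sum => i _; apply: Zh_mul => //; exact: zadj.
  - rewrite !mxE; apply: Zh_add; last apply: Zh_mul; first [exact: Zh_conj (Zh_gen _)|
      by apply: Zh_sum => i _; apply: Zh_mul => //; exact: zadj].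
  have /matrixP /(_ x y) : P + z *: Q = 0.
    rewrite /P /Q -uU adjD adjZ zc mulmxDl !mulmxDr -!scalemxAl -!scalemxAr !scalerA scalerDr scalerA.
    have -> : z * (z * eta^*%C) = 1 by rewrite mulrA -expr2 zeta_exp2S ee.
    rewrite scale1r; set a := A *m adj A; set b := B *m adj B; set c := z *: _; set d := _ *: _.
    apply/matrixP => i j; rewrite !mxE; ring.
  by move: (P) (Q) => p q; rewrite !mxE.
have P0 : A *m adj A + B *m adj B = 1%:M.
  by apply/subr0_eq/matrixP => x y; rewrite (PQ x y).1 mxE.
have Q0 : B *m adj A + eta^*%C *: (A *m adj B) = 0.
  by apply/matrixP => x y; rewrite (PQ x y).2 mxE.
rewrite adjD !adj_tens adj1 mulmxDl !mulmxDr !tens_mul !mulmx1 mul1mx LL -(tens1 m R).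
have -> : tens (A *m adj B) (adj L) = tens (eta^*%C *: (A *m adj B)) L.
  by rewrite adjL; apply/matrixP => x y; rewrite !mxE; ring.
move: P0 Q0; move: (A *m adj A) (B *m adj B) (B *m adj A) (A *m adj B) => a b c d P0 Q0.
rewrite -P0; move: (1%:M : 'M[K]_(2 ^ 1)) (L : 'M[K]_(2 ^ 1)) => I M.
have -> : c = - (eta^*%C *: d) by apply/eqP; rewrite -addr_eq0 Q0.
by apply/matrixP => x y; rewrite !mxE; ring.
Qed.

(** The vector (1, z) is sent by [L] to (z, eta), which is [z] times itself. *)
Lemma embed_attach m (A B : 'M[K]_(2 ^ m)) (l : 'I_(2 ^ 1) -> K) :
  l (ord2 1 1) = z * l (ord2 1 0) ->
  (tens A 1%:M + tens B L) *m attach m l = attach m l *m (A + z *: B).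
Proof.
move=> hl; apply/matrixP => x y.
rewrite mulmxDl mxE !tens_attach attach_mul.
have sE (M : 'M[K]_(2 ^ 1)) w : \sum_u M w u * l u =
    M w (ord2 1 0) * l (ord2 1 0) + M w (ord2 1 1) * l (ord2 1 1).
  rewrite [LHS]big_ord_recl big_ord_recl big_ord0 addr0.
  by congr (M w _ * l _ + M w _ * l _); exact: val_inj.
have i00 : (1%:M : 'M[K]_(2 ^ 1)) (ord2 1 0) (ord2 1 0) = 1 by rewrite mxE.
have i01 : (1%:M : 'M[K]_(2 ^ 1)) (ord2 1 0) (ord2 1 1) = 0 by rewrite mxE.
have i10 : (1%:M : 'M[K]_(2 ^ 1)) (ord2 1 1) (ord2 1 0) = 0 by rewrite mxE.
have i11 : (1%:M : 'M[K]_(2 ^ 1)) (ord2 1 1) (ord2 1 1) = 1 by rewrite mxE.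
have l00 : L (ord2 1 0) (ord2 1 0) = 0 by rewrite mxE.
have l01 : L (ord2 1 0) (ord2 1 1) = 1 by rewrite mxE.
have l10 : L (ord2 1 1) (ord2 1 0) = z * z by rewrite mxE -expr2 zeta_exp2S.
have l11 : L (ord2 1 1) (ord2 1 1) = 0 by rewrite mxE.
have [->|->] : low x = ord2 1 0 \/ low x = ord2 1 1.
- by case: (low x) => -[|[|//]] w; [left|right]; exact: val_inj.
- by rewrite !sE i00 i01 l00 l01 hl [in RHS]mxE [in RHS]mxE; ring.
- by rewrite !sE i10 i11 l10 l11 hl [in RHS]mxE [in RHS]mxE; ring.
Qed.

(** [m.+1 + a] and [m + a.+1] are equal but not convertible, so the circuit is transported along the
    equality; [p] is fixed by its numerical values. *)
Lemma exactly_represents_cast m b n (e : n = (m + b)%N) (C : 'M[K]_(2 ^ n))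
    (p : 'I_(2 ^ m) -> 'I_(2 ^ n)) U gs :
  circuit gs n C -> (forall y, val (p y) = (y * 2 ^ b)%N) ->
  C *m pmx K p = pmx K p *m U -> exactly_represents gs m b U.
Proof.
case: _ / (esym e) in C p * => cC hp.
have -> : pmx K p = pmx K (pad b) by apply: eq_pmx => y; apply: val_inj; rewrite hp val_pad.
by move=> h; apply/exactly_representsE; exists C.
Qed.

(** [D] prepares the eigenvector on the extra ancilla, [C] returns it unchanged, and [D'] takes it
    back to zero. *)
Lemma catalysis m a (U A B : 'M[K]_(2 ^ m)) : U = A + z *: B ->
  exactly_represents (gateset R k) m.+1 a (tens A 1%:M + tens B L) ->
  exactly_represents (gateset R k.+1) m a.+1 U.
Proof.
move=> UE /exactly_representsE[C cC hC].
have k3 : (2 < k.+1)%N by exact: ltnW.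
have k1 : (1 < k.+1)%N by exact: ltnW.
set gs := gateset R k.+1.
have cC' : circuit gs (m.+1 + a) C by exact: gateset_incl.
pose G := mx2 1 0 0 z *m H'mx R.
have aG : avail gs G by apply: avail_mul; [exact: avail_T|exact: avail_H].
pose f := single (ord_max : 'I_m.+1).
have lfi : injective (lshift a \o f) by move=> i j _; rewrite !ord1.
have cD : circuit gs (m.+1 + a) (gmux (lshift a \o f) (fun=> G)) by exact: aG.
have [D' cD' DD'] := gateset_circuit_inverse (ltn0Sn k) cD.
have D'D := mulmx1C DD'; set D := gmux _ _ in cD DD' D'D.
have DE : D *m pmx K (pad a \o @append0 m) = pmx K (pad a) *m attach m (fun u => G u (ord2 1 0)).
  by rewrite -pmx_mul mulmxA gmux_pad -mulmxA gmux_append0.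
apply: (@exactly_represents_cast m a.+1 _ (addSnnS m a) (D' *m (C *m D)) (pad a \o @append0 m)).
- by apply: circuit_mul cD' (circuit_mul cC' cD).
- by move=> y; rewrite (val_pad a (append0 y)) (val_append0 y : nat_of_ord _ = _) expnS mulnA.
(* The first column of [T H'] is proportional to (1, z), the eigenvector required by
   [embed_attach]. *)
have Gl : G (ord2 1 1) (ord2 1 0) = z * G (ord2 1 0) (ord2 1 0).
  by rewrite /G H'mxE mx2_mul !mxE /=; ring.
rewrite -!mulmxA DE [C *m _]mulmxA hC -mulmxA (embed_attach _ _ Gl) -UE.
by rewrite [pmx _ _ *m (_ *m U)]mulmxA -DE !mulmxA D'D mul1mx.
Qed.

Lemma catalytic_step m : (forall (V : 'M[K]_(2 ^ m.+1)), unitary V ->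
    (forall x y, Zh (V x y)) ->
    exists2 a, (a <= k - 2)%N & exactly_represents (gateset R k) m.+1 a V) ->
  forall U : 'M[K]_(2 ^ m), unitary U -> (forall x y, in_Zhalf z (U x y)) ->
  exists2 a, (a <= k.+1 - 2)%N & exactly_represents (gateset R k.+1) m a U.
Proof.
move=> IH U uU zU.
have [A0 hA] := fin_all_exists (fun p : 'I_(2 ^ m) * 'I_(2 ^ m) => Zh_split (zU p.1 p.2)).
have [B0 hB] := fin_all_exists hA.
pose A : 'M[K]_(2 ^ m) := \matrix_(x, y) A0 (x, y).
pose B : 'M[K]_(2 ^ m) := \matrix_(x, y) B0 (x, y).
have zA x y : Zh (A x y) by rewrite mxE; have [] := hB (x, y).
have zB x y : Zh (B x y) by rewrite mxE; have [] := hB (x, y).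
have UE : U = A + z *: B by apply/matrixP => x y; rewrite !mxE; have [] := hB (x, y).
clearbody A B.
have [||a ha rV] := IH (tens A 1%:M + tens B L).
- by apply: embed_unitary => //; rewrite -UE.
- move=> x y; rewrite !mxE; apply: Zh_add; apply: Zh_mul => //; first exact: Zh_bool.
  by case: ifP => _; case: ifP => _; [exact: Zh0|exact: Zh_one|exact: Zh_gen|exact: Zh0].
exists a.+1; first by move: ha k2; lia.
exact: catalysis UE rV.
Qed.

End Catalysis.

(** Each step trades one unit of [k] for one more data qubit, so [m] varies in the induction; the
    base k = 3 contributes the first ancilla. *)
Lemma synth_all (R : realType) k m (U : 'M[R[i]]_(2 ^ m)) : (2 < k)%N -> (0 < m)%N ->
  unitary U -> (forall x y, in_Zhalf (zeta R (2 ^ k)) (U x y)) ->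
  exists2 a, (a <= k - 2)%N & exactly_represents (gateset R k) m a U.
Proof.
move=> k2; rewrite -(subnKC k2); elim: (k - 3)%N m U => [|d IH] m U m0 uU zU.
  by exists 1%N => //; exact: (synth_base (k := 3) isT m0 uU zU).2.
rewrite addnS in zU *; apply: catalytic_step => // V uV zV; exact: IH.
Qed.

Theorem theorem1 (R : realType) (k m : nat) (U : 'M[R[i]]_(2 ^ m)) :
  (0 < k)%N -> (0 < m)%N -> unitary U ->
  ((exists a : nat, exactly_represents (gateset R k) m a U) <->
     (forall x y, in_Zhalf (zeta R (2 ^ k)) (U x y))) /\
  ((forall x y, in_Zhalf (zeta R (2 ^ k)) (U x y)) ->
     exists a : nat, (if (k <= 2)%N then a = 1%N else (a <= k - 2)%N) /\
       exactly_represents (gateset R k) m a U).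
Proof.
move=> k0 m0 uU.
have construct : (forall x y, in_Zhalf (zeta R (2 ^ k)) (U x y)) ->
    exists a : nat, (if (k <= 2)%N then a = 1%N else (a <= k - 2)%N) /\
      exactly_represents (gateset R k) m a U.
  move=> zU; case: leqP => k2.
    have hk : (0 < k <= 3)%N by rewrite k0 ltnW.
    by exists 1%N; split=> //; exact: (synth_base hk m0 uU zU).2.
  by have [a ha ra] := synth_all k2 m0 uU zU; exists a.
split=> //; split=> [[a]|zU]; first exact: Zh_rep.
by have [a [_ ra]] := construct zU; exists a.
Qed.
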